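(* Let $\ell\ge1$ be an integer, and for each integer $m\ge1$ let $r:\mathcal{J}_{2\ell}(m)\to\mathcal{J}_{2\ell}(m-1)$ be the restriction map on universal scalar curvature invariants. Then: 1. $r:\mathcal{J}_{2\ell}(m)\to\mathcal{J}_{2\ell}(m-1)$ is surjective for any $m$. 2. If $m>2\ell$, then $r:\mathcal{J}_{2\ell}(m)\to\mathcal{J}_{2\ell}(m-1)$ is injective. 3. If $m=2\ell$, then $\ker\{r:\mathcal{J}_{2\ell}(m)\to\mathcal{J}_{2\ell}(m-1)\}=\operatorname{Span}\{E_{2\ell,m}\}$.
   Context: An inner product space $(V,\varepsilon)$ of signature $(p,q)$ is a real vector space $V$ of dimension $m=p+q$ with a non-degenerate symmetric bilinear form $\varepsilon$ with $p$ negative and $q$ positive directions. $\varepsilon^*$ denotes the dual inner product on $V^*$. $\mathfrak{A}(V)\subset\otimes^4(V^* )$ is the space of algebraic curvature tensors: those $A$ such that for all $x,y,z,w\in V$, $A(x,y,z,w)=-A(y,x,z,w)=A(z,w,x,y)$ and $A(x,y,z,w)+A(y,z,x,w)+A(z,x,y,w)=0$. For $\sigma\in\operatorname{Perm}(4\ell)$ (permutations of $\{1,\dots,4\ell\}$, $\sigma_i=\sigma(i)$), with respect to any basis $\{e_i\}$ of $V$, with $\varepsilon^{ij}$ the inverse of $\varepsilon_{ij}=\varepsilon(e_i,e_j)$, $A_{ijkl}=A(e_i,e_j,e_k,e_l)$ and summation over repeated indices, set $$P_{2\ell,\sigma,\varepsilon}(A)=\varepsilon^{i_1i_2}\cdots\varepsilon^{i_{4\ell-1}i_{4\ell}}\,A_{i_{\sigma_1}i_{\sigma_2}i_{\sigma_3}i_{\sigma_4}}\cdots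 A_{i_{\sigma_{4\ell-3}}i_{\sigma_{4\ell-2}}i_{\sigma_{4\ell-1}}i_{\sigma_{4\ell}}}.$$ For real constants $\mathcal{C}=\{c_\sigma\}_{\sigma\in\operatorname{Perm}(4\ell)}$ put $P_{2\ell,\mathcal{C},\varepsilon}=\sum_\sigma c_\sigma P_{2\ell,\sigma,\varepsilon}$, a function on $\mathfrak{A}(V)$. $\mathcal{J}_{2\ell}(m)$ is the real vector space of families $P=\{P_\varepsilon\}$ of functions $P_\varepsilon:\mathfrak{A}(V)\to\mathbb{R}$, one for each inner product space $(V,\varepsilon)$ of dimension $m$ (of any signature), for which there is a collection $\mathcal{C}$ with $P_\varepsilon=P_{2\ell,\mathcal{C},\varepsilon}$ for all such $(V,\varepsilon)$. Two families are equal when they are equal as functions; different $\mathcal{C}$ may define the same family. (For any one fixed $(V,\varepsilon)$ of dimension $m$, $P\mapsto P_\varepsilon$ identifies $\mathcal{J}_{2\ell}(m)$ with the space of polynomials on $\mathfrak{A}(V)$, homogeneous of degree $\ell$, that are invariant under the orthogonal group of $\varepsilon$.) In dimension $0$, $\mathcal{J}_{2\ell}(0)=0$. The restriction map $r$ is defined geometrically by $r(P)(N,g_N)(\xi)=P(N\times S^1,g_N\pm d\theta^2)(\xi,\theta_0)$, where $(N,g_N)$ is a pseudo-Riemannian manifold of dimension $m-1$, $\xi\in N$, $\theta_0\in S^1$, and $P(M,g)(x)$ means $P$ evaluated on the curvature tensor of the Levi-Civita connection at $x$. Equivalently: given $(V,\varepsilon)$ of dimension $m-1$ and $A\in\mathfrak{A}(V)$,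 let $V'=V\oplus\mathbb{R}f$, $\varepsilon'=\varepsilon\oplus(\pm1)$ with $f\perp V$ and $\varepsilon'(f,f)=\pm1$, and let $A'\in\mathfrak{A}(V')$ be the extension of $A$ with $A'=0$ whenever one argument is $f$; then $r(P)_\varepsilon(A)=P_{\varepsilon'}(A')$. The choice of sign does not matter. $E_{2\ell,m}\in\mathcal{J}_{2\ell}(m)$ is the Pfaffian, given with respect to any basis by $$E_{2\ell,m,\varepsilon}(A)=\frac{1}{(8\pi)^\ell\,\ell!}\sum_{i_1,\dots,i_{2\ell},j_1,\dots,j_{2\ell}=1}^{m}A_{i_1i_2j_2j_1}\cdots A_{i_{2\ell-1}i_{2\ell}j_{2\ell}j_{2\ell-1}}\ \varepsilon^*(e^{i_1}\wedge\cdots\wedge e^{i_{2\ell}},e^{j_1}\wedge\cdots\wedge e^{j_{2\ell}}),$$ where $\{e^i\}$ is the dual basis and $\varepsilon^*(e^{i_1}\wedge\cdots\wedge e^{i_{k}},e^{j_1}\wedge\cdots\wedge e^{j_{k}})=\det\big(\varepsilon^*(e^{i_a},e^{j_b})\big)_{a,b=1}^{k}$. *)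

(* Defs.v *)
From HB Require Import structures.
From mathcomp Require Import all_boot all_order all_fingroup all_algebra.
From mathcomp Require Import sesquilinear.
From mathcomp Require Import reals trigo.

Set Implicit Arguments.
Unset Strict Implicit.
Unset Printing Implicit Defensive.

Import GRing.Theory.
Local Open Scope ring_scope.

(* No signature is recorded: the spaces of dimension m are those of all
   signatures (p, q) with p + q = m. *)
Record ipspace (R : realType) (m : nat) := IPSpace {
  ips_space :> vectType R;
  ips_form : {symmetric ips_space};
  ips_nondegenerate : nondegenerate ips_form;
  ips_dim : \dim {:ips_space} = m
}.

(* Elements of (x)^4 V^* are 4-linear forms on V. *)
Record curvature_tensor (R : realType) (V : vectType R) := CurvatureTensor {
  ct_fun :> V -> V -> V -> V -> R;
  ct_linear1 : forall y z w, scalar (fun x => ct_fun x y z w);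
  ct_linear2 : forall x z w, scalar (fun y => ct_fun x y z w);
  ct_linear3 : forall x y w, scalar (fun z => ct_fun x y z w);
  ct_linear4 : forall x y z, scalar (fun w => ct_fun x y z w);
  ct_anti : forall x y z w, ct_fun x y z w = - ct_fun y x z w;
  ct_pair : forall x y z w, ct_fun x y z w = ct_fun z w x y;
  ct_bianchi : forall x y z w,
    ct_fun x y z w + ct_fun y z x w + ct_fun z x y w = 0
}.

Record model (R : realType) (m : nat) := Model {
  model_space :> ipspace R m;
  model_tensor : curvature_tensor model_space
}.

(* A family of functions P_eps on the spaces A(V), one for each (V, eps) of
   dimension m, is a function of the triples (V, eps, A).  As V ranges over all
   of vectType R, universe constraints forbid an lmodType structure on this
   type: vector space operations are pointwise, and equality is =1. *)
Definition scalar_family (R : realType) (m : nat) : Type := model R m -> R.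

Lemma slot_subproof (n l : nat) (k : 'I_l) (j : 'I_n) : (n * k + j < n * l)%N.
Proof.
case: k j => k kl [j jn] /=; apply: (@leq_trans (n * k.+1)%N).
  by rewrite mulnS addnC ltn_add2r.
by rewrite leq_mul2l kl orbT.
Qed.

(* Position j (from 0) of the k-th block of n indices (blocks from 0). *)
Definition slot (n l : nat) (k : 'I_l) (j : 'I_n) : 'I_(n * l) :=
  Ordinal (slot_subproof k j).

Section Invariants.
Variables (R : realType) (m : nat).

Section Coordinates.
Variables (M : model R m) (e : seq M).
Let A := model_tensor M.

(* (eps^{ij}); also the matrix of eps^* in the basis dual to e. *)
Definition dual_gram : 'M[R]_m :=
  invmx (\matrix_(i, j) ips_form M e`_i e`_j).

Definition tensor_coef (i j k l : 'I_m) : R := A e`_i e`_j e`_k e`_l.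

(* The factors eps^{i_1 i_2} ... eps^{i_{4l-1} i_{4l}} are grouped two by two. *)
Definition contraction_in (l : nat) (s : 'S_(4 * l)) : R :=
  \sum_(i : {ffun 'I_(4 * l) -> 'I_m})
    (\prod_(k < l) (dual_gram (i (slot k (0 : 'I_4))) (i (slot k (1 : 'I_4))) *
                    dual_gram (i (slot k (2 : 'I_4))) (i (slot k (3 : 'I_4))))) *
    \prod_(k < l) tensor_coef (i (s (slot k (0 : 'I_4))))
                              (i (s (slot k (1 : 'I_4))))
                              (i (s (slot k (2 : 'I_4))))
                              (i (s (slot k (3 : 'I_4)))).

(* eps^*(e^{i_1} /\ ... /\ e^{i_n}, e^{j_1} /\ ... /\ e^{j_n}) *)
Definition wedge_gram (n : nat) (i j : {ffun 'I_n -> 'I_m}) : R :=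
  \det (\matrix_(a < n, b < n) dual_gram (i a) (j b)).

Definition pfaffian_in (l : nat) : R :=
  ((8 * pi) ^+ l * l`!%:R)^-1 *
  \sum_(i : {ffun 'I_(2 * l) -> 'I_m}) \sum_(j : {ffun 'I_(2 * l) -> 'I_m})
    (\prod_(k < l) tensor_coef (i (slot k (0 : 'I_2))) (i (slot k (1 : 'I_2)))
                               (j (slot k (1 : 'I_2))) (j (slot k (0 : 'I_2)))) *
    wedge_gram i j.

End Coordinates.

(* The values below do not depend on the basis; the library's basis is used. *)
Definition contraction (l : nat) (s : 'S_(4 * l)) : scalar_family R m :=
  fun M => contraction_in (vbasis {:M}) s.

Definition pfaffian (l : nat) : scalar_family R m :=
  fun M => pfaffian_in (vbasis {:M}) l.

Definition invariant_of (l : nat) (c : 'S_(4 * l) -> R) : scalar_family R m :=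
  fun M => \sum_(s : 'S_(4 * l)) c s * contraction s M.

(* Membership of P in J_{2l}(m). *)
Definition is_invariant (l : nat) (P : scalar_family R m) : Prop :=
  exists c : 'S_(4 * l) -> R, P =1 invariant_of c.

End Invariants.

Section Extension.
Variables (R : realType) (m : nat) (b : bool) (V : ipspace R m).

(* eps (+) ((-1)^b) on V (+) R f, with f = (0, 1). *)
Definition ext_form (x y : (V * R^o)%type) : R :=
  ips_form V x.1 y.1 + (-1) ^+ b * (x.2 * y.2).

Lemma ext_form_bilinear : bilinear_for
  (GRing.Scale.Law.clone _ _ ( *%R ) _)
  (GRing.Scale.Law.clone _ _ (idfun \; *%R) _) ext_form.
Proof.
split=> [u a x y|u a x y]; rewrite /ext_form /= -[a *: x.2]/(a * x.2).
  rewrite linearPl /= !mulrDr mulrDl mulrDr addrACA; congr (_ + _ + _).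
  by rewrite -mulrA mulrCA.
rewrite linearPr /= !mulrDr addrACA; congr (_ + _ + _).
by rewrite (mulrCA u.2) [RHS]mulrCA.
Qed.

HB.instance Definition _ :=
  bilinear_isBilinear.Build R (V * R^o)%type (V * R^o)%type R
    (GRing.Scale.Law.clone _ _ ( *%R ) _)
    (GRing.Scale.Law.clone _ _ (idfun \; *%R) _) ext_form ext_form_bilinear.

Lemma ext_form_symmetric x y :
  ext_form x y = (-1) ^+ false * idfun (ext_form y x).
Proof.
by rewrite expr0 mul1r /ext_form (mulrC x.2) (hermC (ips_form V)) expr0 mul1r.
Qed.

HB.instance Definition _ :=
  isHermitianSesquilinear.Build R (V * R^o)%type false idfun ext_form
    ext_form_symmetric.

Lemma ext_form_nondegenerate : nondegenerate ext_form.
Proof.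
rewrite /nondegenerate -subv0; apply/subvP => x /mem_orthovP x0.
have xE y : ext_form x y = 0 by apply: x0; rewrite memvf.
rewrite memv0; case: x xE {x0} => x a xE; apply/eqP; congr (_, _).
  apply/eqP; rewrite -memv0 -(eqP (ips_nondegenerate V)).
  apply/mem_orthovP => y _; have := xE (y, 0).
  by rewrite /ext_form /= !mulr0 addr0.
have := xE (0, 1); rewrite /ext_form /= linear0r add0r mulr1.
by move/eqP; rewrite mulf_eq0 signr_eq0 => /eqP.
Qed.

Lemma ext_dim : \dim {:(V * R^o)%type} = m.+1.
Proof. by rewrite -addn1 -[in RHS](ips_dim V) !dimvf. Qed.

Definition ext_space : ipspace R m.+1 :=
  IPSpace ext_form_nondegenerate ext_dim.

Section Tensor.
Variable A : curvature_tensor V.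

(* The 4-linear extension of A vanishing when one argument is f. *)
Definition ext_fun (x y z w : (V * R^o)%type) : R := A x.1 y.1 z.1 w.1.

Definition ext_tensor : curvature_tensor (V * R^o)%type.
Proof.
exists ext_fun.
- by move=> y z w a u v; apply: ct_linear1.
- by move=> x z w a u v; apply: ct_linear2.
- by move=> x y w a u v; apply: ct_linear3.
- by move=> x y z a u v; apply: ct_linear4.
- by move=> x y z w; apply: ct_anti.
- by move=> x y z w; apply: ct_pair.
- by move=> x y z w; apply: ct_bianchi.
Defined.

End Tensor.
End Extension.

(* The restriction map r, computed with the sign (-1)^b. *)
Definition restriction (R : realType) (m : nat) (b : bool)
    (P : scalar_family R m.+1) : scalar_family R m :=
  fun M => P (@Model _ _ (ext_space b M) (ext_tensor (model_tensor M))).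

(* Main.v *)
From HB Require Import structures.
Require Import Defs.
From mathcomp Require Import all_boot all_order all_fingroup all_algebra.
From mathcomp Require Import sesquilinear ring lra zify.
From mathcomp Require Import reals trigo.

Set Implicit Arguments.
Unset Strict Implicit.
Unset Printing Implicit Defensive.

Import GRing.Theory Num.Theory.
Local Open Scope ring_scope.

(** In an orthogonal basis every contraction is a polynomial in the components of
    the curvature tensor, and the same coefficients define it in every dimension
    and signature.  A component with an index in the direction of the extra factor
    f vanishes, so the restriction of the invariant with coefficients c is the
    invariant with coefficients c one dimension lower
    ([restriction_contraction]).  Hence the restriction is well defined, onto, and
    independent of the sign chosen for f.

    Suppose that an invariant P restricts to zero.  Then P vanishes on every
    curvature tensor that omits some basis direction, so by inclusion-exclusion
    only the monomials that involve all m indices contribute to P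
    ([inv_val_surj]).  As the metric matches the 4l indices in 2l pairs, at most
    2l different indices occur, and P = 0 if m > 2l ([vanishing_step]).

    Let m = 2l.  In a contributing monomial each index now occurs exactly twice,
    the metric enters only through the product of its diagonal entries
    ([inv_coef_scale]), and the definite metric may be studied alone.  Polarizing P
    and evaluating it at the curvature tensors generated by single components
    gives a function f on the colourings i of the 4l slots by the 2l indices
    ([polarized]), from which P is recovered ([polarized_inv_val]).  This f is a
    combination of indicators of matchings, has the symmetries of a curvature
    tensor in each block of four slots, and vanishes as soon as a colour is
    missing.  If the slots a, b have one colour and c, d another, giving all four
    the first colour frees the second, while there are three ways to match four
    slots; so the sum of f over these three ways is zero ([matching_merge]).
    This relation turns an exchange of colours between two slots into a sign
    whenever the term matching these two slots vanishes ([exchange]).  In a block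
    of four slots the exchange contradicts the symmetry of the Ricci contraction,
    and then the Bianchi identity, unless the block is matched within itself in
    the way (0 3)(1 2) ([block_zero]).  Thus f is determined by its values on the
    colourings that match every block within itself; these form one orbit under
    renaming of the colours ([std_color_orbit]), so f lies in a line.  The
    Pfaffian is a combination of contractions ([pfaffian_contractions]), vanishes
    in dimensions below 2l ([pfaffian_low]) and is not zero on the unit sphere
    ([pfaffian_sphere]); it therefore spans the kernel ([vanishing_kernel]). *)

(** * Numbering of the tensor slots *)

Local Notation i4_0 := (0 : 'I_4).
Local Notation i4_1 := (1 : 'I_4).
Local Notation i4_2 := (2 : 'I_4).
Local Notation i4_3 := (3 : 'I_4).

Lemma slot_inj n l (k k' : 'I_l) (j j' : 'I_n) :
  slot k j = slot k' j' -> k = k' /\ j = j'.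
Proof.
move=> /(congr1 val) /= E.
have n0 : (0 < n)%N by apply: leq_ltn_trans (ltn_ord j).
have Ej : j = j' :> nat.
  by rewrite -(modn_small (ltn_ord j)) -(modn_small (ltn_ord j')) -(modnMDl k)
     -[RHS](modnMDl k') ![(_ * n)%N]mulnC E.
split; apply: val_inj => //=; move: E; rewrite Ej => /addIn /eqP.
by rewrite eqn_mul2l; case: (n) n0 => // ? _ /eqP.
Qed.

Lemma slot_bij n l :
  bijective (fun u : 'I_l * 'I_n => slot u.1 u.2).
Proof.
apply: inj_card_bij => [[k j] [k' j'] /= /slot_inj [-> ->] //|].
by rewrite card_prod !card_ord mulnC.
Qed.

Lemma slotP n l (x : 'I_(n * l)) : exists k j, x = slot (k : 'I_l) (j : 'I_n).
Proof. by have [v vK Kv] := @slot_bij n l; exists (v x).1, (v x).2; rewrite Kv. Qed.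

Lemma ord4_case (j : 'I_4) (P : 'I_4 -> Prop) :
  P 0 -> P 1 -> P 2 -> P 3 -> P j.
Proof.
move=> P0 P1 P2 P3; case: j => [[|[|[|[|//]]]] hj].
- by rewrite (_ : Ordinal hj = 0) //; apply: val_inj.
- by rewrite (_ : Ordinal hj = 1) //; apply: val_inj.
- by rewrite (_ : Ordinal hj = 2) //; apply: val_inj.
- by rewrite (_ : Ordinal hj = 3) //; apply: val_inj.
Qed.

Lemma big_ord4 (S : Type) (idx : S) (op : Monoid.law idx) (F : 'I_4 -> S) :
  \big[op/idx]_(j < 4) F j = op (op (op (F 0) (F 1)) (F 2)) (F 3).
Proof.
rewrite !big_ord_recr big_ord0 /= Monoid.mul1m.
by congr (op (op (op (F _) (F _)) (F _)) (F _)); apply: val_inj.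
Qed.

(** The metric factors join adjacent slots.  A slot is therefore also an end c of
    one of the two metric factors, numbered by b, of its block; products over the
    metric factors become products over the pairs q. *)
Definition ord4_of (b c : bool) : 'I_4 :=
  if b then (if c then 3 else 2) else (if c then 1 else 0).

Definition pslot l (q : 'I_l * bool) (c : bool) : 'I_(4 * l) :=
  slot q.1 (ord4_of q.2 c).

Lemma pslot_inj l (q q' : 'I_l * bool) c c' :
  pslot q c = pslot q' c' -> q = q' /\ c = c'.
Proof.
move: q q' => [k b] [k' b'] /slot_inj /= [-> ].
by case: b b' c c' => [] [] [] [].
Qed.

Lemma pslot_bij l :
  bijective (fun u : ('I_l * bool) * bool => pslot u.1 u.2).
Proof.
apply: inj_card_bij => [[q c] [q' c'] /= /pslot_inj [-> ->] //|].
by rewrite !card_prod !card_bool !card_ord -mulnA mulnC.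
Qed.

Lemma pslotP l (x : 'I_(4 * l)) : exists q c, x = pslot q c.
Proof. by have [v vK Kv] := @pslot_bij l; exists (v x).1, (v x).2; rewrite Kv. Qed.

Section Distribution.
Variables (R : comNzRingType) (C : finType).

(** Distributivity, when the choices made in the factors assemble into a single
    function on all the slots. *)
Lemma prod_sum_reindex (X Y Z : finType) (u : Y -> Z -> X)
    (G : Y -> {ffun Z -> C} -> R) :
  bijective (fun yz => u yz.1 yz.2) ->
  \prod_y \sum_b G y b =
  \sum_(a : {ffun X -> C}) \prod_y G y [ffun z => a (u y z)].
Proof.
move=> [v uK vK]; rewrite bigA_distr_bigA /=.
rewrite (reindex (fun a : {ffun X -> C} => [ffun y => [ffun z => a (u y z)]])).
  by apply: eq_bigr => a _; apply: eq_bigr => y _; rewrite ffunE.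
exists (fun B : {ffun Y -> {ffun Z -> C}} => [ffun x => B (v x).1 (v x).2]).
  by move=> a _; apply/ffunP => x; rewrite !ffunE (vK x).
by move=> B _; apply/ffunP => y; apply/ffunP => z; rewrite !ffunE (uK (y, z)).
Qed.

Lemma sum_ffun4 (g : C -> C -> C -> C -> R) :
  \sum_(b : {ffun 'I_4 -> C}) g (b 0) (b 1) (b 2) (b 3) =
  \sum_p \sum_q \sum_r \sum_s g p q r s.
Proof.
rewrite pair_bigA pair_bigA pair_bigA /=.
pose h (b : {ffun 'I_4 -> C}) := (b 0, b 1, b 2, b 3).
rewrite [RHS](reindex h); first by apply: eq_bigr.
exists (fun u => [ffun j : 'I_4 => nth u.1.1.1 [:: u.1.1.1; u.1.1.2; u.1.2; u.2] j]).
  by move=> b _; apply/ffunP => j; rewrite ffunE /h /=; elim/ord4_case: j.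
by move=> [[[p q] r] s] _; rewrite /h /= !ffunE.
Qed.

Lemma sum_ffun2 (g : C -> C -> R) :
  \sum_(b : {ffun bool -> C}) g (b false) (b true) = \sum_p \sum_q g p q.
Proof.
rewrite pair_bigA /=.
pose h (b : {ffun bool -> C}) := (b false, b true).
rewrite [RHS](reindex h); first by apply: eq_bigr.
exists (fun u => [ffun c : bool => if c then u.2 else u.1]).
  by move=> b _; apply/ffunP => [[]]; rewrite ffunE /h /=.
by move=> [p q] _; rewrite /h /= !ffunE.
Qed.

Lemma prod_sum4 l (G : 'I_l -> C -> C -> C -> C -> R) :
  \prod_k \sum_p \sum_q \sum_r \sum_s G k p q r s =
  \sum_(a : {ffun 'I_(4 * l) -> C}) \prod_k
    G k (a (slot k i4_0)) (a (slot k i4_1)) (a (slot k i4_2)) (a (slot k i4_3)).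
Proof.
under eq_bigr => k _ do rewrite -sum_ffun4.
rewrite (@prod_sum_reindex 'I_(4 * l) _ _ (fun k j => slot k j)) //.
  by apply: eq_bigr => a _; apply: eq_bigr => k _; rewrite !ffunE.
exact: slot_bij.
Qed.

Lemma prod_sum2 l (G : 'I_l * bool -> C -> C -> R) :
  \prod_q \sum_p \sum_p' G q p p' =
  \sum_(a : {ffun 'I_(4 * l) -> C}) \prod_q
    G q (a (pslot q false)) (a (pslot q true)).
Proof.
under eq_bigr => k _ do rewrite -sum_ffun2.
rewrite (@prod_sum_reindex 'I_(4 * l) _ _ (fun k j => pslot k j)) //.
  by apply: eq_bigr => a _; apply: eq_bigr => k _; rewrite !ffunE.
exact: pslot_bij.
Qed.

Lemma prod_slot4 l (g : 'I_(4 * l) -> R) :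
  \prod_x g x = \prod_k
    (g (slot k i4_0) * g (slot k i4_1) * g (slot k i4_2) * g (slot k i4_3)).
Proof.
rewrite (reindex _ (onW_bij _ (@slot_bij 4 l))) -(pair_bigA _ (fun k j => g (slot k j))).
by apply: eq_bigr => k _; rewrite big_ord4.
Qed.

Lemma prod_pslot l (g : 'I_(4 * l) -> R) :
  \prod_x g x = \prod_q (g (pslot q false) * g (pslot q true)).
Proof.
rewrite (reindex _ (onW_bij _ (@pslot_bij l))) -(pair_bigA _ (fun k j => g (pslot k j))).
by apply: eq_bigr => k _; rewrite big_bool mulrC.
Qed.

End Distribution.

Lemma sum_ffun_perm (V : nmodType) (X C : finType) (s : {perm X})
    (F : {ffun X -> C} -> V) :
  \sum_i F i = \sum_(i : {ffun X -> C}) F [ffun x => i (s x)].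
Proof.
rewrite (reindex (fun i : {ffun X -> C} => [ffun x => i (s x)])) //.
exists (fun i : {ffun X -> C} => [ffun x => i (s^-1%g x)]) => i _;
  apply/ffunP => x; rewrite !ffunE ?permK ?permKV //.
Qed.

(** * Contractions in coordinates *)

Section Contractions.
Variables (R : idomainType) (l : nat).
Implicit Type s : 'S_(4 * l).

Definition metric_prod (C : finType) (D : C -> C -> R) (i : 'I_(4 * l) -> C) : R :=
  \prod_(k < l) (D (i (slot k i4_0)) (i (slot k i4_1)) *
                 D (i (slot k i4_2)) (i (slot k i4_3))).

Definition tensor_prod (C : finType) (T : C -> C -> C -> C -> R)
    (i : 'I_(4 * l) -> C) : R :=
  \prod_(k < l) T (i (slot k i4_0)) (i (slot k i4_1))
                  (i (slot k i4_2)) (i (slot k i4_3)).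

Definition contract (C : finType) D (T : C -> C -> C -> C -> R) s : R :=
  \sum_(i : {ffun 'I_(4 * l) -> C}) metric_prod D i * tensor_prod T (i \o s).

Lemma metric_prodE (C : finType) (D : C -> C -> R) i :
  metric_prod D i = \prod_q D (i (pslot q false)) (i (pslot q true)).
Proof.
rewrite -(pair_bigA _ (fun k b => D (i (pslot (k, b) false)) (i (pslot (k, b) true)))).
by apply: eq_bigr => k _; rewrite big_bool mulrC.
Qed.

Lemma eq_metric_prod (C : finType) (D : C -> C -> R) i j :
  i =1 j -> metric_prod D i = metric_prod D j.
Proof. by move=> E; apply: eq_bigr => k _; rewrite !E. Qed.

Lemma eq_tensor_prod (C : finType) (T : C -> C -> C -> C -> R) i j :
  i =1 j -> tensor_prod T i = tensor_prod T j.
Proof. by move=> E; apply: eq_bigr => k _; rewrite !E. Qed.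

(** With the permutation moved from the tensors to the metric, the tensor factor
    is common to all the contractions of an invariant. *)
Lemma contractE (C : finType) D (T : C -> C -> C -> C -> R) s :
  contract D T s = \sum_(i : {ffun 'I_(4 * l) -> C})
    metric_prod D (i \o s^-1%g) * tensor_prod T i.
Proof.
rewrite /contract (sum_ffun_perm s^-1%g); apply: eq_bigr => i _; congr (_ * _).
  by apply: eq_metric_prod => x; rewrite /= ffunE.
by apply: eq_tensor_prod => x; rewrite /= ffunE permK.
Qed.

(** Covariance of the tensor and contravariance of the metric cancel slot by
    slot, because the summation over all indices factors through the slots. *)
Lemma contract_change (C : finType) (g : C -> C -> R) (D D' : C -> C -> R)
    (T T' : C -> C -> C -> C -> R) s :
  (forall p q r t, T' p q r t = \sum_a \sum_b \sum_c \sum_d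
     g p a * g q b * g r c * g t d * T a b c d) ->
  (forall a b, D a b = \sum_p \sum_q D' p q * (g p a * g q b)) ->
  contract D' T' s = contract D T s.
Proof.
move=> T'E DE; rewrite contractE [RHS]contractE.
have TE (i : {ffun 'I_(4 * l) -> C}) : tensor_prod T' i =
    \sum_(a : {ffun 'I_(4 * l) -> C}) (\prod_x g (i x) (a x)) * tensor_prod T a.
  rewrite /tensor_prod; under eq_bigr => k _ do rewrite T'E.
  rewrite (prod_sum4 (fun k a b c d => _)); apply: eq_bigr => a _.
  by rewrite big_split prod_slot4.
under eq_bigr => i _ do rewrite TE big_distrr /=.
rewrite exchange_big /=; apply: eq_bigr => a _.
under eq_bigr => i _ do rewrite mulrA.
rewrite -big_distrl /=; congr (_ * _).
rewrite metric_prodE; under [RHS]eq_bigr => q _ do rewrite DE.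
rewrite (prod_sum2 (fun q p p' => D' p p' * (g p _ * g p' _))).
rewrite (sum_ffun_perm s) /=; apply: eq_bigr => i _.
rewrite big_split /= metric_prodE; congr (_ * _).
  by apply: eq_bigr => q _; rewrite /= !ffunE !permKV.
rewrite -(prod_pslot (fun x => g (i x) (a (s^-1%g x)))).
rewrite [RHS](reindex_inj (@perm_inj _ s)) /=.
by apply: eq_bigr => x _; rewrite !ffunE permK.
Qed.

(** An index function with a value outside the image of h kills the tensor
    product, so the metric need only be known on that image. *)
Lemma contract_inj (C C' : finType) (h : C' -> C) (D : C -> C -> R)
    (T : C -> C -> C -> C -> R) (D' : C' -> C' -> R)
    (T' : C' -> C' -> C' -> C' -> R) s :
  injective h ->
  (forall a b, D' a b = D (h a) (h b)) ->
  (forall a b c d, T' a b c d = T (h a) (h b) (h c) (h d)) ->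
  (forall p q r t, T p q r t != 0 -> all (fun x => x \in codom h) [:: p; q; r; t]) ->
  contract D T s = contract D' T' s.
Proof.
move=> hI DE TE T0; rewrite contractE [RHS]contractE.
pose H (a : {ffun 'I_(4 * l) -> C'}) := [ffun x => h (a x)].
have HI : injective H.
  by move=> a b /ffunP E; apply/ffunP => x; apply: hI; have := E x; rewrite !ffunE.
rewrite (bigID (fun i => i \in H @: setT)) /= [X in _ + X]big1 ?addr0; last first.
  move=> i iH; apply/eqP; rewrite mulf_eq0; apply/orP; right.
  apply: contraR iH => /prodf_neq0 ik.
  have iC x : i x \in codom h.
    have [k [j ->]] := slotP x; have /T0 := ik k isT.
    by case/and5P => ? ? ? ? _; elim/ord4_case: j.
  apply/imsetP; exists [ffun x => iinv (iC x)] => //; apply/ffunP => x.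
  by rewrite !ffunE f_iinv.
rewrite big_imset /=; last by move=> a b _ _; apply: HI.
rewrite (eq_bigl xpredT) => [|a]; last by rewrite inE.
apply: eq_bigr => a _; congr (_ * _).
  by apply: eq_bigr => k _; rewrite /= !ffunE !DE.
by apply: eq_bigr => k _; rewrite !ffunE TE.
Qed.

End Contractions.

(** * Bases and models *)

Lemma scalar_0 (R : pzRingType) (V : lmodType R) (f : V -> R) :
  scalar f -> f 0 = 0.
Proof. by move=> fl; have := fl (-1) 0 0; rewrite scaler0 add0r mulN1r addNr. Qed.

Lemma scalar_sum (R : pzRingType) (V : lmodType R) (f : V -> R) (I : Type)
    (r : seq I) (u : I -> R) (v : I -> V) :
  scalar f -> f (\sum_(a <- r) u a *: v a) = \sum_(a <- r) u a * f (v a).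
Proof.
move=> fl; apply: (big_rec2 (fun x y => f x = y)) => [|a x y _ <-].
  exact: scalar_0.
exact: fl.
Qed.

Section Bases.
Variables (R : realType) (m : nat).
Implicit Types (M : model R m) (V : ipspace R m).

Definition gram V (e : seq V) : 'M[R]_m := \matrix_(i, j) ips_form V e`_i e`_j.

Lemma basis_size V (e : seq V) : basis_of fullv e -> size e == m.
Proof. by case/andP => /eqP eE /eqP <-; rewrite eE ips_dim. Qed.

(** Non-degeneracy of the form: a vector in the left kernel of the Gram matrix
    is orthogonal to a spanning family. *)
Lemma gram_unit V (e : seq V) : basis_of fullv e -> gram e \in unitmx.
Proof.
move=> eB; have es := basis_size eB; pose t := Tuple es.
rewrite -row_free_unit -kermx_eq0; apply/eqP/row_matrixP => i; rewrite row0.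
set u := row i _; have uG : u *m gram e = 0.
  by apply/sub_kermxP; rewrite row_sub.
pose x := \sum_(j < m) u 0 j *: t`_j.
have x0 : x = 0.
  apply/eqP; rewrite -memv0 -(eqP (ips_nondegenerate V)).
  apply/mem_orthovP => y _; rewrite (@coord_basis _ _ _ _ t y eB (memvf _)).
  rewrite linear_sumr /= big1 // => b _; rewrite linearZr /=.
  apply/eqP; rewrite mulf_eq0; apply/orP; right; apply/eqP.
  rewrite linear_sumlz -[RHS](_ : (u *m gram e) 0 b = 0); last by rewrite uG mxE.
  rewrite [RHS]mxE; apply: eq_bigr => a _.
  by rewrite linearZl_LR /= [gram e _ _]mxE.
apply/rowP => j; rewrite [RHS]mxE.
have /freeP := (basis_free eB : free t) => /(_ (fun j => u 0 j)); apply.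
exact: x0.
Qed.

Lemma contraction_inE M (e : seq M) l (s : 'S_(4 * l)) :
  contraction_in e s = contract (dual_gram e) (tensor_coef e) s.
Proof. by []. Qed.

(** If g expresses e' in e, the Gram matrix of e' is g G g^T and its inverse
    transforms contragrediently. *)
Lemma contraction_basis M (e e' : seq M) l (s : 'S_(4 * l)) :
  basis_of fullv e -> basis_of fullv e' ->
  contraction_in e' s = contraction_in e s.
Proof.
move=> eB e'B; have es := basis_size eB; pose t := Tuple es.
pose g := \matrix_(p < m, a < m) coord t a e'`_p.
have e'E (p : 'I_m) : e'`_p = \sum_(a < m) g p a *: e`_a.
  rewrite {1}(@coord_basis _ _ _ _ t e'`_p eB (memvf _)).
  by apply: eq_bigr => a _; rewrite mxE.
apply: (@contract_change _ _ _ (fun p a => g p a)).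
  move=> p q r d; rewrite /tensor_coef 4!e'E.
  rewrite (scalar_sum _ _ _ (ct_linear1 _ _ _ _)); apply: eq_bigr => a _.
  rewrite (scalar_sum _ _ _ (ct_linear2 _ _ _ _)) big_distrr; apply: eq_bigr => b _.
  rewrite (scalar_sum _ _ _ (ct_linear3 _ _ _ _)) !big_distrr; apply: eq_bigr => c _.
  rewrite (scalar_sum _ _ _ (ct_linear4 _ _ _ _)) !big_distrr; apply: eq_bigr => f _.
  by rewrite /= !mulrA.
have GE : gram e' = g *m gram e *m g^T.
  apply/matrixP => p q; rewrite mxE 2!e'E linear_sumr mxE; apply: eq_bigr => b _.
  rewrite linearZr /= linear_sumlz mulrC !mxE; congr (_ * _).
  by apply: eq_bigr => a _; rewrite linearZl_LR /= [gram e _ _]mxE.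
have DE : dual_gram e = g^T *m dual_gram e' *m g.
  rewrite /dual_gram -!/(gram _).
  have G'U := gram_unit e'B; have gU : g^T \in unitmx.
    by move: G'U; rewrite GE !unitmx_mul => /andP[].
  apply: (can_inj (mulmxK (gram_unit eB))); rewrite mulVmx ?gram_unit //.
  apply: (can_inj (mulmxK gU)); rewrite mul1mx.
  have : g^T *m (invmx (gram e') *m (g *m gram e *m g^T)) = g^T.
    by rewrite -GE mulVmx // mulmx1.
  by rewrite !mulmxA => ->.
move=> a b; rewrite DE mxE exchange_big; apply: eq_bigr => q _ /=.
rewrite mxE big_distrl /=; apply: eq_bigr => p _; rewrite [g^T _ _]mxE.
by rewrite (mulrC (g p a)) -mulrA.
Qed.

Lemma contractionE M (e : seq M) l (s : 'S_(4 * l)) : basis_of fullv e ->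
  contraction s M = contract (dual_gram e) (tensor_coef e) s.
Proof. by move=> eB; rewrite -contraction_inE; exact/contraction_basis/vbasisP. Qed.

(** A symmetric form that is not identically zero on a subspace is, by
    polarization, nonzero on some diagonal pair; splitting off that vector
    leaves a hyperplane of the subspace. *)
Lemma orthogonal_basis_sub V n (U : {vspace V}) : \dim U = n ->
  exists2 e : seq V, basis_of U e &
    forall i j, i != j -> ips_form V e`_i e`_j = 0.
Proof.
elim: n U => [|n IH] U dU.
  exists [::]; last by move=> i j _; rewrite !nth_nil linear0r.
  by rewrite basisEfree nil_free span_nil sub0v dU.
have [U0|] := boolP (U <= orthov (ips_form V) U)%VS.
  exists (vbasis U); first exact: vbasisP.
  move=> i j _; have [hi|hi] := ltnP i (size (vbasis U)); last first.
    by rewrite nth_default // linear0l.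
  have [hj|hj] := ltnP j (size (vbasis U)); last first.
    by rewrite [X in ips_form V _ X]nth_default // linear0r.
  move/orthovP: U0; apply; apply: vbasis_mem; exact: mem_nth.
case/subvPn => x xU /mem_orthovPn[y yU xy].
(* The value of the form at x + y is twice its value at (x, y). *)
have [u uU uu] : exists2 u, u \in U & ips_form V u u != 0.
  have [x0|] := eqVneq (ips_form V x x) 0; last by exists x.
  have [y0|] := eqVneq (ips_form V y y) 0; last by exists y.
  exists (x + y); first exact: memvD.
  rewrite linearDr !linearDl /= x0 y0 add0r addr0 (hermC _ y) expr0 mul1r /=.
  by rewrite -mulr2n mulrn_eq0.
have uO : u \notin orthov (ips_form V) U.
  by apply/mem_orthovPn; exists u.
have [|e /andP[/eqP eS eF] eO] := IH (U :&: orthov (ips_form V) <[u]>)%VS.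
  by rewrite -eq_dim_orthov1 // dU.
have eu i : ips_form V u e`_i = 0.
  have [hi|hi] := ltnP i (size e); last by rewrite nth_default // linear0r.
  have : e`_i \in orthov (ips_form V) <[u]>.
    have : e`_i \in (U :&: orthov (ips_form V) <[u]>)%VS.
      by rewrite -eS; apply/memv_span/mem_nth.
    by rewrite memv_cap => /andP[].
  rewrite mem_orthov1 => /eqP E.
  by rewrite hermC E rmorph0 mulr0.
exists (u :: e).
  rewrite basisEfree free_cons eF span_cons eS andbT; apply/and3P; split.
  - by rewrite memv_cap uU mem_orthov1.
  - by rewrite subv_add -memvE uU capvSl.
  by rewrite dU /= -(eqP eF) eS -eq_dim_orthov1 // dU.
move=> [|i] [|j] //= ij; [by rewrite hermC eu rmorph0 mulr0|exact: eO].
Qed.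

Lemma dual_gram_diag V (e : seq V) (g : 'I_m -> R) : basis_of fullv e ->
  (forall a b : 'I_m, ips_form V e`_a e`_b = g a *+ (a == b)) ->
  (forall a, g a != 0) /\
  forall a b, invmx (gram e) a b = (g a)^-1 *+ (a == b).
Proof.
move=> eB eO; have gE : gram e = diag_mx (\row_a g a).
  by apply/matrixP => a b; rewrite !mxE eO.
have g0 a : g a != 0.
  have := gram_unit eB; rewrite gE unitmxE det_diag unitfE.
  by move/prodf_neq0/(_ a isT); rewrite mxE.
split=> // a b; have -> : invmx (gram e) = diag_mx (\row_a (g a)^-1).
  apply: (can_inj (mulmxK (gram_unit eB))); rewrite mulVmx ?gram_unit // gE.
  rewrite mulmx_diag -diag_const_mx; congr diag_mx.
  by apply/rowP => c; rewrite !mxE mulVf.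
by rewrite !mxE.
Qed.

End Bases.

Record curvature_like (R : zmodType) (C : Type)
    (T : C -> C -> C -> C -> R) : Prop := CurvatureLike {
  cl_anti : forall p q r s, T p q r s = - T q p r s;
  cl_pair : forall p q r s, T p q r s = T r s p q;
  cl_bianchi : forall p q r s, T p q r s + T q r p s + T r p q s = 0
}.

Definition diag_metric (R : nmodType) (C : eqType) (d : C -> R) (a b : C) : R :=
  d a *+ (a == b).

(** Orthogonal bases exist in every signature, so diagonal metrics suffice. *)
Lemma model_coords (R : realType) m (M : model R m) :
  exists d : 'I_m -> R, exists2 T, curvature_like T &
    (forall a, d a != 0) /\ forall l (s : 'S_(4 * l)),
      contraction s M = contract (diag_metric d) T s.
Proof.
have [e eB eO] := orthogonal_basis_sub (ips_dim M).
have eO' (a b : 'I_m) :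
    ips_form M e`_a e`_b = ips_form M e`_a e`_a *+ (a == b).
  by case: eqVneq => [->|/eO].
have [d0 dE] := dual_gram_diag eB eO'.
exists (fun a : 'I_m => (ips_form M e`_a e`_a)^-1); exists (tensor_coef e);
    last split=> [a|l s]; rewrite ?invr_eq0 //.
  split=> *; [exact: ct_anti | exact: ct_pair | exact: ct_bianchi].
rewrite (contractionE _ eB); apply: eq_bigr => i _; congr (_ * _).
by apply: eq_bigr => k _; rewrite /dual_gram -/(gram e) !dE.
Qed.

Section CoordinateModel.
Variables (R : realType) (m : nat) (d : 'I_m -> R) (d0 : forall a, d a != 0).
Variables (T : 'I_m -> 'I_m -> 'I_m -> 'I_m -> R) (clT : curvature_like T).

Definition diag_form (u v : 'rV[R]_m) : R := \sum_a (d a)^-1 * (u 0 a * v 0 a).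

Lemma diag_form_bilinear : bilinear_for
  (GRing.Scale.Law.clone _ _ ( *%R ) _)
  (GRing.Scale.Law.clone _ _ (idfun \; *%R) _) diag_form.
Proof.
split=> [u a x y|u a x y]; rewrite /diag_form /= mulr_sumr -big_split;
  apply: eq_bigr => b _; rewrite !mxE /=; ring.
Qed.

HB.instance Definition _ :=
  bilinear_isBilinear.Build R 'rV[R]_m 'rV[R]_m R
    (GRing.Scale.Law.clone _ _ ( *%R ) _)
    (GRing.Scale.Law.clone _ _ (idfun \; *%R) _) diag_form diag_form_bilinear.

Lemma diag_form_symmetric x y :
  diag_form x y = (-1) ^+ false * idfun (diag_form y x).
Proof.
rewrite expr0 mul1r; apply: eq_bigr => a _; congr (_ * _); exact: mulrC.
Qed.

HB.instance Definition _ :=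
  isHermitianSesquilinear.Build R 'rV[R]_m false idfun diag_form
    diag_form_symmetric.

Lemma diag_form_delta x a : diag_form x (delta_mx 0 a) = (d a)^-1 * x 0 a.
Proof.
rewrite /diag_form (bigD1 a) //= big1 ?addr0 => [|b ba].
  by rewrite !mxE !eqxx mulr1.
by rewrite mxE eqxx (negPf ba) /= !mulr0.
Qed.

Lemma diag_form_nondegenerate : nondegenerate diag_form.
Proof.
rewrite /nondegenerate -subv0; apply/subvP => x /mem_orthovP x0.
rewrite memv0; apply/eqP/rowP => a; have := x0 (delta_mx 0 a) (memvf _).
rewrite /= diag_form_delta mxE => /eqP; rewrite mulf_eq0 invr_eq0 (negPf (d0 a)).
by move/eqP.
Qed.

Definition coord_space : ipspace R m.
Proof.
apply: (IPSpace diag_form_nondegenerate).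
by rewrite dimvf -[RHS]mul1n.
Defined.

Let Ix : Type := ('I_m * 'I_m * 'I_m * 'I_m)%type.

Definition coord_fun (x y z w : 'rV[R]_m) : R :=
  \sum_(p : 'I_m * 'I_m * 'I_m * 'I_m)
    x 0 p.1.1.1 * y 0 p.1.1.2 * z 0 p.1.2 * w 0 p.2 *
    T p.1.1.1 p.1.1.2 p.1.2 p.2.

Definition coord_tensor : curvature_tensor 'rV[R]_m.
Proof.
exists coord_fun.
- move=> y z w k u v; rewrite /coord_fun mulr_sumr -big_split.
  by apply: eq_bigr => p _; rewrite !mxE /=; ring.
- move=> y z w k u v; rewrite /coord_fun mulr_sumr -big_split.
  by apply: eq_bigr => p _; rewrite !mxE /=; ring.
- move=> y z w k u v; rewrite /coord_fun mulr_sumr -big_split.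
  by apply: eq_bigr => p _; rewrite !mxE /=; ring.
- move=> y z w k u v; rewrite /coord_fun mulr_sumr -big_split.
  by apply: eq_bigr => p _; rewrite !mxE /=; ring.
- move=> x y z w; rewrite /coord_fun -sumrN.
  pose h (p : Ix) : Ix := (p.1.1.2, p.1.1.1, p.1.2, p.2).
  have hK : cancel h h by case=> [[[? ?] ?] ?].
  rewrite (reindex_inj (can_inj hK)) /=; apply: eq_bigr => p _.
  by rewrite (cl_anti clT); ring.
- move=> x y z w; rewrite /coord_fun.
  pose h (p : Ix) : Ix := (p.1.2, p.2, p.1.1.1, p.1.1.2).
  have hK : cancel h h by case=> [[[? ?] ?] ?].
  rewrite (reindex_inj (can_inj hK)) /=; apply: eq_bigr => p _.
  by rewrite (cl_pair clT); ring.
move=> x y z w; rewrite /coord_fun.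
pose h (p : Ix) : Ix := (p.1.1.2, p.1.2, p.1.1.1, p.2).
have hK : cancel h (h \o h) by case=> [[[? ?] ?] ?].
rewrite [X in _ + X + _](reindex_inj (can_inj hK)) /=.
rewrite [X in _ + X](reindex_inj (inj_comp (can_inj hK) (can_inj hK))) /=.
rewrite -!big_split big1 //= => p _.
have := cl_bianchi clT p.1.1.1 p.1.1.2 p.1.2 p.2.
move=> /(congr1 (fun t => x 0 p.1.1.1 * y 0 p.1.1.2 * z 0 p.1.2 * w 0 p.2 * t)).
by rewrite mulr0 => <-; ring.
Defined.

Lemma coord_fun_delta a b c e : coord_fun (delta_mx 0 a) (delta_mx 0 b)
  (delta_mx 0 c) (delta_mx 0 e) = T a b c e.
Proof.
rewrite /coord_fun (bigD1 (a, b, c, e)) //= big1 ?addr0 => [|[[[a' b'] c'] e']].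
  by rewrite !mxE !eqxx !mul1r.
rewrite !xpair_eqE !negb_and -!orbA !mxE !eqxx /=.
by case/or4P => /negPf->; rewrite ?mul0r ?mulr0 ?mul0r.
Qed.

(** Conversely, all such coordinate data come from a model; this transfers
    hypotheses on all models to hypotheses on components. *)
Lemma coords_model : exists M : model R m, forall l (s : 'S_(4 * l)),
  contraction s M = contract (diag_metric d) T s.
Proof.
pose M := @Model R m coord_space coord_tensor; exists M => l s.
pose e : seq M := [seq delta_mx 0 a | a <- enum 'I_m].
have eE (a : 'I_m) : e`_a = delta_mx 0 a.
  by rewrite (nth_map a) ?nth_ord_enum // size_enum_ord.
have eB : basis_of fullv e.
  rewrite basisEdim size_map size_enum_ord (ips_dim M) leqnn andbT.
  apply/subvP => x _; rewrite (row_sum_delta x); apply: memv_suml => a _.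
  by apply/memvZ/memv_span/map_f; rewrite mem_enum.
have eO (a b : 'I_m) : ips_form M e`_a e`_b = (d a)^-1 *+ (a == b).
  by rewrite !eE /= diag_form_delta mxE eqxx eq_sym; case: eqP => [->|]; rewrite ?mulr1 ?mulr0.
have [_ dE] := dual_gram_diag eB eO.
rewrite (contractionE _ eB); apply: eq_bigr => i _; congr (_ * _); apply: eq_bigr => k _.
  by rewrite /dual_gram -/(gram e) !dE !invrK.
by rewrite /tensor_coef !eE; exact: coord_fun_delta.
Qed.

End CoordinateModel.

(** In a basis adapted to V (+) R f the extended tensor vanishes as soon as one
    index is that of f, so the contraction never sees the extra direction. *)
Lemma restriction_contraction (R : realType) m b l (s : 'S_(4 * l)) (M : model R m) :
  restriction b (contraction s) M = contraction s M.
Proof.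
rewrite /restriction; set M' := Model _.
have eB := vbasisP {:M}; set e : seq M := vbasis _ in eB *.
have es : size e = m by apply/eqP/basis_size.
pose e' : seq M' := (0, 1) :: [seq (x, 0) | x <- e].
have e'E (a : 'I_m) : e'`_(lift ord0 a) = (e`_a, 0).
  by rewrite lift0 /= (nth_map 0) ?es.
have e'B : basis_of fullv e'.
  rewrite basisEdim /= size_map es (ips_dim M') leqnn andbT.
  apply/subvP => -[x k] _.
  have -> : (x, k) = \sum_(a < m) coord (Tuple (basis_size eB)) a x *: (e`_a, 0) + k *: (0, 1) :> M'.
    have xE := @coord_basis _ _ _ _ (Tuple (basis_size eB)) x eB (memvf _).
    have -> : \sum_(a < m) coord (Tuple (basis_size eB)) a x *: ((e`_a, 0) : M') = (x, 0).
      rewrite [in RHS]xE; apply: (big_rec2 (fun p q => p = (q, 0))) => // a p q _ ->.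
      by congr pair; rewrite /= scaler0 addr0.
    by congr pair; rewrite /= ?scaler0 ?addr0 // add0r -[k *: _]/(k * 1) mulr1.
  apply: memvD; last by apply/memvZ/memv_span; rewrite mem_head.
  apply: memv_suml => a _; apply/memvZ/memv_span; rewrite -e'E; apply: mem_nth.
  by rewrite lift0 /= size_map es ltnS.
have L0 : lshift m (0 : 'I_1) = ord0 by apply: val_inj.
rewrite (contractionE _ e'B) (contractionE _ eB).
apply: (@contract_inj _ _ _ _ (lift ord0)); first exact: lift_inj.
- move=> a c; rewrite /dual_gram -/(gram e) -/(gram e').
  have gE : gram e' = block_mx ((-1) ^+ b)%:M 0 0 (gram e) :> 'M_(1 + m).
    apply/matrixP => i j; rewrite mxE /= /ext_form.
    case: (unliftP ord0 i) => [i' ->|->]; case: (unliftP ord0 j) => [j' ->|->].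
    - by rewrite !e'E -!rshift1 block_mxEdr mxE /= mul0r mulr0 addr0.
    - rewrite e'E -rshift1 -L0 block_mxEdl mxE /= mul0r mulr0 addr0; exact: linear0r.
    - rewrite e'E -rshift1 -L0 block_mxEur mxE /= mulr0 mulr0 addr0; exact: linear0l.
    by rewrite -L0 block_mxEul mxE /= linear0l add0r !mulr1.
  have bU : ((-1) ^+ b)%:M \in @unitmx R 1.
    by rewrite unitmxE det_scalar1 unitrX ?unitrN1.
  have -> : invmx (gram e') =
      block_mx (invmx ((-1) ^+ b)%:M) 0 0 (invmx (gram e)) :> 'M_(1 + m).
    rewrite gE; apply: invmx_block_diag.
    by rewrite unitmxE det_ublock unitrM -!unitmxE bU gram_unit.
  by rewrite -!rshift1; apply: esym; apply: block_mxEdr.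
- by move=> p q r t; rewrite /tensor_coef !e'E.
move=> p q r t; apply: contraR => H; apply/eqP.
rewrite /tensor_coef /= /ext_fun; move: H.
case: (unliftP ord0 p) => [p' ->|->]; last by rewrite /= (scalar_0 (ct_linear1 _ _ _ _)).
case: (unliftP ord0 q) => [q' ->|->]; last by rewrite /= (scalar_0 (ct_linear2 _ _ _ _)).
case: (unliftP ord0 r) => [r' ->|->]; last by rewrite /= (scalar_0 (ct_linear3 _ _ _ _)).
case: (unliftP ord0 t) => [t' ->|->]; last by rewrite /= (scalar_0 (ct_linear4 _ _ _ _)).
by rewrite /= !codom_f.
Qed.

(** * Index functions that miss no index *)

Definition im (X C : finType) (i : X -> C) : {set C} := [set i x | x : X].

(** If the sum over the functions valued in S vanishes for every proper S, then
    by induction on S so does the sum over the functions with image exactly S,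
    and only the surjections remain. *)
Lemma sum_surjections (V : zmodType) (X C : finType) (F : {ffun X -> C} -> V) :
  (forall S : {set C}, S != setT -> \sum_(i : {ffun X -> C} | im i \subset S) F i = 0) ->
  \sum_i F i = \sum_(i : {ffun X -> C} | im i == setT) F i.
Proof.
move=> F0; pose G S := \sum_(i : {ffun X -> C} | im i == S) F i.
have G0 n (S : {set C}) : (#|S| <= n)%N -> S != setT -> G S = 0.
  elim: n S => [|n IH] S.
    rewrite leqn0 cards_eq0 => /eqP -> s0; rewrite -[RHS](F0 _ s0).
    by apply: eq_bigl => i; rewrite subset0.
  move=> cS ST; have := F0 _ ST.
  rewrite (partition_big (fun i : {ffun X -> C} => im i) (fun S' => S' \subset S)) //=.
  rewrite (bigD1 S) //= [X in _ + X = _]big1 ?addr0.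
    move=> <-; apply: eq_bigl => i; case: eqP => [->|]; rewrite ?subxx //.
    by rewrite andbF.
  move=> S' /andP[sS nS]; rewrite -[RHS](IH S').
  - apply: eq_bigl => i; case: eqP => [->|]; rewrite ?andbT ?andbF //.
  - rewrite -ltnS (leq_trans _ cS) // proper_card // properEneq nS //.
  apply: contraNneq nS => E; rewrite eqEsubset sS E; apply: subsetT.
rewrite (partition_big (fun i : {ffun X -> C} => im i) predT) //=.
rewrite (bigD1 setT) //= [X in _ + X]big1 ?addr0 // => S nS.
exact: (G0 #|S|).
Qed.

Lemma im_perm (X C : finType) (i : X -> C) (s : {perm X}) : im (i \o s) = im i.
Proof.
apply/setP => a; apply/imsetP/imsetP => -[x _ ->]; first by exists (s x).
by exists (s^-1%g x); rewrite //= permKV.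
Qed.

Section Diagonal.
Variables (R : idomainType) (C : finType) (l : nat).
Implicit Types (c : 'S_(4 * l) -> R) (d : C -> R).
Implicit Type T : C -> C -> C -> C -> R.

(** The coefficients of the invariant as a polynomial in the components of T,
    before the symmetries of T identify some of the monomials. *)
Definition inv_coef c (D : C -> C -> R) (i : 'I_(4 * l) -> C) : R :=
  \sum_s c s * metric_prod D (i \o s^-1%g).

Definition inv_val c (D : C -> C -> R) T : R := \sum_s c s * contract D T s.

Lemma inv_valE c D T :
  inv_val c D T = \sum_(i : {ffun 'I_(4 * l) -> C}) inv_coef c D i * tensor_prod T i.
Proof.
rewrite /inv_val; under eq_bigr => s _ do rewrite contractE mulr_sumr.
rewrite exchange_big; apply: eq_bigr => i _ /=; rewrite mulr_suml.
by apply: eq_bigr => s _; rewrite mulrA.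
Qed.

(** The restriction of T to the coordinate subspace spanned by S, extended by
    zero to the other coordinate directions. *)
Definition cut (S : {set C}) T p q r t : R :=
  T p q r t *+ (all (fun x => x \in S) [:: p; q; r; t]).

Lemma cut_curvature S T : curvature_like T -> curvature_like (cut S T).
Proof.
case=> TA TP TB; rewrite /cut /=; split=> p q r t; rewrite !andbT.
- by rewrite TA mulNrn andbCA.
- by rewrite TP; congr (_ *+ _); do 4 case: (_ \in S).
case: (p \in S); case: (q \in S); case: (r \in S); case: (t \in S);
  by rewrite ?mulr0n ?addr0 // !mulr1n.
Qed.

Lemma tensor_prod_cut S T (i : 'I_(4 * l) -> C) :
  tensor_prod (cut S T) i = tensor_prod T i *+ (im i \subset S).
Proof.
have [/subsetP iS|] := boolP (im i \subset S).
  by apply: eq_bigr => k _; rewrite /cut /= !iS ?imset_f.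
case/subsetPn => _ /imsetP[x _ ->] xS; have [k [j xE]] := slotP x.
rewrite /tensor_prod (bigD1 k) //= /cut /=; move: xS; rewrite {}xE.
elim/ord4_case: j => /negPf->;
  by rewrite ?andbF ?mulr0n ?mul0r.
Qed.

Lemma metric_prod_diag d (j : 'I_(4 * l) -> C) :
  metric_prod (diag_metric d) j = (\prod_q d (j (pslot q false))) *+
    [forall q, j (pslot q false) == j (pslot q true)].
Proof.
rewrite metric_prodE; case: forallP => [E|].
  by apply: eq_bigr => q _; rewrite /diag_metric E.
move/forallP/forallPn => [q /negPf E]; rewrite (bigD1 q) //= /diag_metric E.
by rewrite mul0r.
Qed.

Section Surjective.
Variables (j : 'I_(4 * l) -> C) (js : im j = setT).
Hypothesis jE : [forall q, j (pslot q false) == j (pslot q true)].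

Lemma paired_surj : codom (fun q => j (pslot q false)) =i predT.
Proof.
move=> a; rewrite inE; have : a \in im j by rewrite js inE.
case/imsetP => x _ ->; have [q [[] ->]] := pslotP x; rewrite -?(eqP (forallP jE q));
  exact: (codom_f (fun q => j (pslot q false))).
Qed.

(** The function j factors through the 2l pairs. *)
Lemma paired_card : (#|C| <= 2 * l)%N.
Proof.
rewrite -(eq_card paired_surj); apply: leq_trans (leq_image_card _ _) _.
by rewrite card_prod card_ord card_bool mulnC.
Qed.

Lemma paired_bij : #|C| = (2 * l)%N -> bijective (fun q => j (pslot q false)).
Proof.
move=> cC; have cQ : #|{: 'I_l * bool}| = #|C|.
  by rewrite cC card_prod card_ord card_bool mulnC.
apply: inj_card_bij; last by rewrite cQ.
apply/injectiveP; rewrite /injectiveb /dinjectiveb; apply/card_uniqP.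
by rewrite size_image -/(codom _) (eq_card paired_surj) -cQ.
Qed.

End Surjective.

(** A contraction involves at most 2l different indices. *)
Lemma inv_coef_card c d (i : 'I_(4 * l) -> C) :
  im i = setT -> (2 * l < #|C|)%N -> inv_coef c (diag_metric d) i = 0.
Proof.
move=> iS lC; apply: big1 => s _; rewrite metric_prod_diag.
have sS : im (i \o s^-1%g) = setT by rewrite im_perm.
by case: (boolP [forall _, _]) => [/(paired_card sS)|]; rewrite ?mulr0 // leqNgt lC.
Qed.

(** A surjection onto 2l indices that is constant on the 2l pairs takes each
    value on exactly one pair, so the metric contributes a constant factor. *)
Lemma inv_coef_scale c d (i : 'I_(4 * l) -> C) :
  im i = setT -> #|C| = (2 * l)%N ->
  inv_coef c (diag_metric d) i =
  (\prod_a d a) * inv_coef c (diag_metric (fun=> 1)) i.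
Proof.
move=> iS lC; rewrite mulr_sumr; apply: eq_bigr => s _; rewrite !metric_prod_diag.
have sS : im (i \o s^-1%g) = setT by rewrite im_perm.
case: (boolP [forall _, _]) => [E|]; rewrite ?mulr0 //.
rewrite big1_eq !mulr1n mulr1 mulrC; congr (_ * _).
by rewrite [RHS](reindex _ (onW_bij _ (paired_bij sS E lC))).
Qed.

End Diagonal.

(** That the invariant is zero in dimension n, in terms of orthogonal bases only;
    the numbers d are the diagonal entries of the inverse metric. *)
Definition vanishing (R : realType) l (c : 'S_(4 * l) -> R) n : Prop :=
  forall (d : 'I_n -> R) T, (forall a, d a != 0) -> curvature_like T ->
  inv_val c (diag_metric d) T = 0.

Section Vanishing.
Variables (R : realType) (l n : nat) (c : 'S_(4 * l) -> R).
Hypothesis c0 : vanishing c n.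
Variable d : 'I_n.+1 -> R.
Hypothesis d0 : forall a, d a != 0.

(** The tensor [cut S T] lives on a coordinate hyperplane, where the hypothesis
    applies whatever the sign of the metric in the normal direction. *)
Lemma inv_val_cut (S : {set 'I_n.+1}) T : S != setT -> curvature_like T ->
  inv_val c (diag_metric d) (cut S T) = 0.
Proof.
rewrite -subTset => /subsetPn[y _ yS] clT.
pose T' a b e f := cut S T (lift y a) (lift y b) (lift y e) (lift y f).
have [CA CP CB] := cut_curvature S clT.
rewrite -[RHS](@c0 (d \o lift y) T') => [|a|]; first last.
- by split=> *; rewrite /T'; [apply: CA | apply: CP | apply: CB].
- exact: d0.
apply: eq_bigr => s _; congr (_ * _); apply: (@contract_inj _ _ _ _ (lift y)) => //.
- exact: lift_inj.
- by move=> a b; rewrite /diag_metric (inj_eq lift_inj).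
move=> p q r t; rewrite /cut; case: (boolP (all _ _)); last by rewrite eqxx.
move=> /allP H _; apply/allP => x /H xS.
case: (unliftP y x) xS => [x' -> _|->]; first exact: codom_f.
by rewrite (negPf yS).
Qed.

(** Every monomial that matters involves all the indices. *)
Lemma inv_val_surj T : curvature_like T ->
  inv_val c (diag_metric d) T =
  \sum_(i : {ffun 'I_(4 * l) -> 'I_n.+1} | im i == setT)
     inv_coef c (diag_metric d) i * tensor_prod T i.
Proof.
move=> clT; rewrite inv_valE; apply: sum_surjections => S ST.
rewrite -[RHS](inv_val_cut ST clT) inv_valE big_mkcond; apply: eq_bigr => i _.
by rewrite tensor_prod_cut; case: (im i \subset S); rewrite ?mulr0.
Qed.

End Vanishing.

(** * The curvature symmetrizer *)

Section Symmetrizer.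
Variables (R : comNzRingType) (C : finType).
Let array := C -> C -> C -> C -> R.
Implicit Type T : array.

Definition swap01 T : array := fun p q r t => T q p r t.
Definition swap12 T : array := fun p q r t => T p r q t.
Definition swap23 T : array := fun p q r t => T p q t r.

Definition antisym T : array := fun p q r t =>
  T p q r t - swap01 T p q r t - swap23 T p q r t + swap01 (swap23 T) p q r t.

Definition pairsym T : array := fun p q r t =>
  T p q r t + swap12 (swap01 (swap23 (swap12 T))) p q r t.

Definition bianchi T : array := fun p q r t =>
  2 * T p q r t - swap01 (swap12 T) p q r t - swap12 (swap01 T) p q r t.

(** Up to the factor 24, the projection of 4-tensors onto curvature tensors:
    impose the antisymmetries and the pair symmetry, then subtract the totally
    antisymmetric part, which is the Bianchi sum. *)
Definition symmetrize T : array := bianchi (pairsym (antisym T)).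

Lemma symmetrize_curvature T : curvature_like (symmetrize T).
Proof.
split=> p q r t;
  rewrite /symmetrize /bianchi /pairsym /antisym /swap01 /swap12 /swap23; ring.
Qed.

(** The antisymmetrizations and the pair symmetry multiply by 8, and the Bianchi
    combination multiplies by 3 since the two cyclic shifts add up to -T. *)
Lemma symmetrize_id T : curvature_like T ->
  forall p q r t, symmetrize T p q r t = 24 * T p q r t.
Proof.
move=> [TA TP TB] p q r t.
have TA' a b c d : T a b c d = - T a b d c by rewrite TP TA TP.
have SE a b c d : pairsym (antisym T) a b c d = 8 * T a b c d.
  rewrite /pairsym /antisym /swap01 /swap12 /swap23.
  rewrite (TA b a) (TA' a b d c) (TA' b a d c) (TA b a) (TP c d) (TP d c).
  by rewrite (TP c d b a) (TP d c b a) (TA b a c d) (TA' a b d c) (TA b a d c) (TA' a b d c); ring.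
rewrite /symmetrize /bianchi /swap01 /swap12 !SE.
have -> : T r p q t = - (T p q r t + T q r p t).
  by apply/eqP; rewrite -addr_eq0 addrC TB.
ring.
Qed.

Definition quad (p q r t : C) (j : 'I_4) : C := nth p [:: p; q; r; t] j.

(** Operators in the image of the group algebra of S_4.  That the symmetrizer is
    one of them is what keeps the polarized invariant a combination of
    matchings. *)
Definition perm_op (Op : array -> array) : Prop :=
  exists k : 'S_4 -> R, forall T p q r t, Op T p q r t = \sum_s k s *
    T (quad p q r t (s 0)) (quad p q r t (s 1)) (quad p q r t (s 2)) (quad p q r t (s 3)).

Lemma quadK (x : 'I_4 -> C) : quad (x 0) (x 1) (x 2) (x 3) =1 x.
Proof. by move=> j; elim/ord4_case: j. Qed.

(** The coefficients of a composite are given by convolution. *)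
Lemma perm_op_comp Op1 Op2 : perm_op Op1 -> perm_op Op2 ->
  perm_op (fun T => Op1 (Op2 T)).
Proof.
move=> [k1 E1] [k2 E2].
exists (fun w => \sum_s k1 s * k2 (w * s^-1)%g) => T p q r t; rewrite E1.
under eq_bigr => s _ do rewrite E2 mulr_sumr.
under [RHS]eq_bigr => w _ do rewrite mulr_suml.
rewrite [RHS]exchange_big; apply: eq_bigr => s _ /=.
rewrite [RHS](reindex_inj (mulIg s)) /=; apply: eq_bigr => u _.
by rewrite mulgK mulrA !permM !(quadK (fun j => quad p q r t (s j))).
Qed.

Lemma perm_op_id : perm_op id.
Proof.
exists (fun s => (s == 1%g)%:R) => T p q r t.
rewrite (bigD1 1%g) //= big1 ?addr0 => [|s /negPf->]; last by rewrite mul0r.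
by rewrite eqxx mul1r !perm1.
Qed.

Lemma perm_op_lin (a b : R) Op1 Op2 : perm_op Op1 -> perm_op Op2 ->
  perm_op (fun T p q r t => a * Op1 T p q r t + b * Op2 T p q r t).
Proof.
move=> [k1 E1] [k2 E2]; exists (fun s => a * k1 s + b * k2 s) => T p q r t.
rewrite E1 E2 !mulr_sumr -big_split; apply: eq_bigr => s _ /=; ring.
Qed.

Lemma perm_op_ext Op1 Op2 : (forall T p q r t, Op1 T p q r t = Op2 T p q r t) ->
  perm_op Op1 -> perm_op Op2.
Proof. by move=> E [k Ek]; exists k => T p q r t; rewrite -E Ek. Qed.

Lemma perm_op_perm (s : 'S_4) : perm_op (fun T p q r t =>
  T (quad p q r t (s 0)) (quad p q r t (s 1)) (quad p q r t (s 2)) (quad p q r t (s 3))).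
Proof.
exists (fun s' => (s' == s)%:R) => T p q r t.
rewrite (bigD1 s) //= big1 ?addr0 => [|s' /negPf->]; last by rewrite mul0r.
by rewrite eqxx mul1r.
Qed.

Lemma perm_op_symmetrize : perm_op symmetrize.
Proof.
have P01 : perm_op swap01.
  apply: perm_op_ext (perm_op_perm (tperm 0 1)) => T p q r t.
  by rewrite tpermL tpermR !tpermD.
have P12 : perm_op swap12.
  apply: perm_op_ext (perm_op_perm (tperm 1 2)) => T p q r t.
  by rewrite tpermL tpermR !tpermD.
have P23 : perm_op swap23.
  apply: perm_op_ext (perm_op_perm (tperm 2 3)) => T p q r t.
  by rewrite tpermL tpermR !tpermD.
have PA : perm_op antisym.
  have H := perm_op_lin 1 1 (perm_op_lin 1 (-1) perm_op_id P01)
    (perm_op_lin (-1) 1 P23 (perm_op_comp P01 P23)).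
  by apply: perm_op_ext H => T p q r t; rewrite /antisym; ring.
have PP : perm_op pairsym.
  have H := perm_op_lin 1 1 perm_op_id
    (perm_op_comp P12 (perm_op_comp P01 (perm_op_comp P23 P12))).
  by apply: perm_op_ext H => T p q r t; rewrite /pairsym; ring.
have PB : perm_op bianchi.
  have H := perm_op_lin 2 (-1) perm_op_id
    (perm_op_lin 1 1 (perm_op_comp P01 P12) (perm_op_comp P12 P01)).
  by apply: perm_op_ext H => T p q r t; rewrite /bianchi; ring.
exact: perm_op_comp PB (perm_op_comp PP PA).
Qed.

Definition delta_array (p q r t : C) : array := fun a b c d =>
  (p == a)%:R * (q == b)%:R * (r == c)%:R * (t == d)%:R.

(** The integral kernel of the symmetrizer, or the curvature tensor generated by
    the single component (p, q, r, t). *)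
Definition curvature_kernel p q r t : array := symmetrize (delta_array p q r t).

(** The symmetrizer is self-adjoint, so its kernel is also curvature-like in the
    indices of the generating component. *)
Lemma kernel_anti01 p q r t a b c d :
  curvature_kernel q p r t a b c d = - curvature_kernel p q r t a b c d.
Proof.
rewrite /curvature_kernel /symmetrize /bianchi /pairsym /antisym /swap01 /swap12 /swap23 /delta_array; ring.
Qed.

Lemma kernel_pair p q r t a b c d :
  curvature_kernel r t p q a b c d = curvature_kernel p q r t a b c d.
Proof.
rewrite /curvature_kernel /symmetrize /bianchi /pairsym /antisym /swap01 /swap12 /swap23 /delta_array; ring.
Qed.

Lemma kernel_bianchi p q r t a b c d :
  curvature_kernel p q r t a b c d + curvature_kernel q r p t a b c d +
  curvature_kernel r p q t a b c d = 0.
Proof.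
rewrite /curvature_kernel /symmetrize /bianchi /pairsym /antisym /swap01 /swap12 /swap23 /delta_array; ring.
Qed.

Lemma sum_kernel T a b c d :
  \sum_p \sum_q \sum_r \sum_t curvature_kernel p q r t a b c d * T p q r t =
  symmetrize T a b c d.
Proof.
have [k E] := perm_op_symmetrize; rewrite /curvature_kernel E.
rewrite -(sum_ffun4 (fun p q r t => symmetrize (delta_array p q r t) a b c d * T p q r t)).
under eq_bigr => p _ do rewrite E mulr_suml.
rewrite exchange_big; apply: eq_bigr => s _ /=; set x := quad a b c d.
rewrite (bigD1 [ffun j => x (s j)]) //= big1 ?addr0 => [|p].
  by rewrite !ffunE /delta_array !eqxx !mulr1.
apply: contraNeq => H; apply/eqP/ffunP => j; rewrite ffunE; apply/eqP.
move: H; apply: contraNT; rewrite /delta_array.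
by elim/ord4_case: j => /negPf->; rewrite ?(mulr0, mul0r).
Qed.

Lemma kernel_perm : exists k : 'S_4 -> R, forall p q r t (x : 'I_4 -> C),
  curvature_kernel p q r t (x 0) (x 1) (x 2) (x 3) =
  \sum_s k s * ([forall j, quad p q r t j == x (s j)])%:R.
Proof.
have [k E] := perm_op_symmetrize; exists k => p q r t x.
rewrite /curvature_kernel E; apply: eq_bigr => s _; rewrite !quadK /delta_array.
congr (_ * _); rewrite -!natrM !mulnb; congr (_%:R); congr nat_of_bool.
apply/idP/forallP => [/andP[/andP[/andP[? ?] ?] ?] j|H].
  by elim/ord4_case: j.
by rewrite (H 0) (H 1) (H 2) (H 3).
Qed.

End Symmetrizer.

(** * Pairing functionals *)

Lemma curvature_like_sum (R : pzRingType) (C I : finType) (P : pred I) (u : I -> R)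
    (T : I -> C -> C -> C -> C -> R) :
  (forall i, curvature_like (T i)) ->
  curvature_like (fun p q r t => \sum_(i | P i) u i * T i p q r t).
Proof.
move=> cT; split=> p q r t.
- by rewrite -sumrN; apply: eq_bigr => i _; case: (cT i) => TA _ _; rewrite TA mulrN.
- by apply: eq_bigr => i _; case: (cT i) => _ TP _; rewrite TP.
rewrite -!big_split big1 // => i _ /=.
by case: (cT i) => _ _ TB; rewrite -!mulrDr TB mulr0.
Qed.

Section Pairing.
Variables (R : idomainType) (C : finType) (l : nat).
Let X := 'I_(4 * l).

Definition paired (i : X -> C) : bool :=
  [forall q, i (pslot q false) == i (pslot q true)].

Lemma metric_prod_paired (i : X -> C) :
  metric_prod (diag_metric (fun=> 1 : R)) i = (paired i)%:R.
Proof. by rewrite metric_prod_diag big1_eq. Qed.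

(** An invariant functional of the orthogonal group on the 4l-fold tensor power
    of the Euclidean space with orthonormal basis C, given by its values on the
    tensor products of basis vectors. *)
Definition pairing_sum (f : (X -> C) -> R) : Prop :=
  exists w : {perm X} -> R, forall i, f i = \sum_s w s * (paired (i \o s))%:R.

Lemma eq_paired (i j : X -> C) : i =1 j -> paired i = paired j.
Proof. by move=> E; apply: eq_forallb => q; rewrite !E. Qed.

Lemma pairing_sum_perm f (s : {perm X}) :
  pairing_sum f -> pairing_sum (fun i => f (i \o s)).
Proof.
move=> [w E]; exists (fun u => w (u * s^-1)%g) => i; rewrite E.
rewrite [RHS](reindex_inj (mulIg s)) /=; apply: eq_bigr => u _; rewrite mulgK.
by congr (_ * _%:R); rewrite (@eq_paired _ (i \o (u * s)%g)) // => x /=; rewrite permM.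
Qed.

Lemma pairing_sum_sum (I : finType) (f : I -> (X -> C) -> R) :
  (forall a, pairing_sum (f a)) -> pairing_sum (fun i => \sum_a f a i).
Proof.
move=> H; have [w E] := fin_all_exists H.
exists (fun s => \sum_a w a s) => i; under eq_bigr => a _ do rewrite E.
by rewrite exchange_big; apply: eq_bigr => s _; rewrite mulr_suml.
Qed.

Lemma pairing_sum_scale a f : pairing_sum f -> pairing_sum (fun i => a * f i).
Proof.
move=> [w E]; exists (fun s => a * w s) => i; rewrite E mulr_sumr.
by apply: eq_bigr => s _; rewrite mulrA.
Qed.

Lemma pairing_sum_ext f g : f =1 g -> pairing_sum f -> pairing_sum g.
Proof. by move=> E [w Ew]; exists w => i; rewrite -E. Qed.

Section Values.
Variables (f : (X -> C) -> R) (fP : pairing_sum f).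

Lemma pairing_sum_eq i j : i =1 j -> f i = f j.
Proof.
case: fP => w E ij; rewrite !E; apply: eq_bigr => s _; congr (_ * _%:R).
by rewrite (@eq_paired _ (j \o s)) // => x /=.
Qed.

Lemma pairing_sum_color (u : C -> C) i : injective u -> f (u \o i) = f i.
Proof.
case: fP => w E uI; rewrite !E; apply: eq_bigr => s _; congr (_ * _%:R).
by congr nat_of_bool; apply: eq_forallb => q /=; rewrite (inj_eq uI).
Qed.

Lemma pairing_sum_neq0 i : f i != 0 -> exists s : {perm X}, paired (i \o s).
Proof.
case: fP => w -> H; apply/existsP; apply: contraNT H => /existsPn H.
by rewrite big1 // => s _; rewrite (negPf (H s)) mulr0.
Qed.

End Values.

(** A matching is easier to follow as the involution that exchanges the two slots
    of each pair. *)
Lemma matching_exists (s : {perm X}) : exists M : X -> X,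
  [/\ involutive M, forall x, M x != x &
      forall i : X -> C, paired (i \o s) = [forall x, i (M x) == i x]].
Proof.
have [v vK Kv] := @pslot_bij l.
pose m x := pslot (v x).1 (~~ (v x).2).
have mE q c : m (pslot q c) = pslot q (~~ c) by rewrite /m (vK (q, c)).
have mm : involutive m.
  by move=> x; have [q [c ->]] := pslotP x; rewrite !mE negbK.
exists (s \o m \o s^-1%g); split=> [x|x|i] /=.
- by rewrite permK mm permKV.
- have [q [c E]] := pslotP (s^-1%g x); rewrite E mE -(permKV s x) E.
  by rewrite (inj_eq perm_inj); apply/eqP => /pslot_inj[_]; case: c {E}.
apply/forallP/forallP => [H x|H q].
  rewrite -[x](permKV s) permK; have [q [c ->]] := pslotP (s^-1%g x); rewrite mE.
  by have /eqP /= := H q; case: c => /= ->.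
by have := H (s (pslot q true)); rewrite /= permK mE.
Qed.

(** Exactly one of the three ways to match four slots of the same colour is
    chosen by a matching; recolouring two of the four slots detects which. *)
Lemma matching_merge (M : X -> X) (i : X -> C) (a b c d : X) :
  involutive M -> (forall x, M x != x) ->
  (forall z, (i z == i a) = (z == a) || (z == b)) ->
  (forall z, (i z == i c) = (z == c) || (z == d)) ->
  a != b -> c != d -> i a != i c ->
  let D (j : X -> C) := [forall x, j (M x) == j x] in
  (D i + D (i \o tperm b c) + D (i \o tperm b d))%N =
  D (fun x => if i x == i c then i a else i x) :> nat.
Proof.
move=> MM M0 ia ic ab cd ac D; set r := fun x => _.
(* The colouring j is matched iff r is and the partner of a has the colour that
   j gives to a. *)
have key (j : X -> C) b' c' d' :
    (forall z, (j z == i a) = (z == a) || (z == b')) ->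
    (forall z, (j z == i c) = (z == c') || (z == d')) ->
    (fun x => if j x == i c then i a else j x) =1 r ->
    D j = (D r && (M a == b')).
  move=> ja jc jr.
  have jaE : j a = i a by apply/eqP; rewrite ja eqxx.
  have jb'E : j b' = i a by apply/eqP; rewrite ja eqxx orbT.
  apply/forallP/andP => [H|[/forallP H /eqP Mab] x].
    split; first by apply/forallP => x; rewrite -!jr (eqP (H x)).
    by have := H a; rewrite jaE ja (negPf (M0 a)).
  have Mba : M b' = a by rewrite -Mab MM.
  have [jx|jxa] := boolP (j x == i a).
    by move: (jx); rewrite ja => /orP[] /eqP ->; rewrite ?Mab ?Mba jaE jb'E.
  have := H x; rewrite -!jr; case: ifP => [/eqP jMc|jMc]; case: ifP => [/eqP jxc|jxc] //.
  - by rewrite jMc jxc.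
  - by rewrite eq_sym (negPf jxa).
  rewrite ja => /orP[] /eqP E; move: jxa; rewrite -(MM x) E ?Mab ?Mba.
    by rewrite jb'E eqxx.
  by rewrite jaE eqxx.
have iaE : i b = i a by apply/eqP; rewrite ia eqxx orbT.
have icE : i d = i c by apply/eqP; rewrite ic eqxx orbT.
have neq x y : i x = i a -> i y = i c -> (x == y) = false.
  by move=> xE yE; apply: contraNF ac => /eqP xy; rewrite -xE xy yE.
have bc := neq b c iaE erefl; have bd := neq b d iaE icE.
have a_c := neq a c erefl erefl; have a_d := neq a d erefl icE.
have cb : (c == b) = false by rewrite eq_sym.
have db : (d == b) = false by rewrite eq_sym.
have dc : (d == c) = false by rewrite eq_sym; apply/negbTE.
have ba : (b == a) = false by rewrite eq_sym; apply/negbTE.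
have ca : (c == a) = false by rewrite eq_sym.
have da : (d == a) = false by rewrite eq_sym.
rewrite (key i b c d) // (key (i \o tperm b c) c b d) ?bd //; first last.
- by move=> x; rewrite /r /=; case: (tpermP b c x) => [->|->|//]; rewrite ?iaE eqxx (negPf ac).
- by move=> z /=; rewrite ic !(inv_eq (tpermK b c)) tpermR tpermD ?bd // eq_sym dc.
- by move=> z /=; rewrite ia !(inv_eq (tpermK b c)) tpermL tpermD ?ba ?ca // orbC.
rewrite (key (i \o tperm b d) d b c) ?bc //; first last.
- by move=> x; rewrite /r /=; case: (tpermP b d x) => [->|->|//]; rewrite ?iaE ?icE eqxx (negPf ac).
- by move=> z /=; rewrite ic !(inv_eq (tpermK b d)) tpermR tpermD ?bc ?dc // orbC.
- by move=> z /=; rewrite ia !(inv_eq (tpermK b d)) tpermL tpermD ?ba ?da // orbC.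
case: (boolP (D r)) => [/forallP/(_ a)|_] //=; rewrite {2}/r (negPf ac).
have cd0 : (c == d) = false by apply/negbTE.
rewrite /r; case: ifP => [|_].
  by rewrite ic => /orP[] /eqP ->; rewrite ?cb ?dc ?db ?eqxx ?cd0.
by rewrite ia (negPf (M0 a)) => /eqP ->; rewrite eqxx bc bd.
Qed.

Lemma pairing_sum_merge f (i : X -> C) (a b c d : X) : pairing_sum f ->
  (forall z, (i z == i a) = (z == a) || (z == b)) ->
  (forall z, (i z == i c) = (z == c) || (z == d)) ->
  a != b -> c != d -> i a != i c ->
  f i + f (i \o tperm b c) + f (i \o tperm b d) =
  f (fun x => if i x == i c then i a else i x).
Proof.
move=> [w E] ia ic ab cd ac; rewrite !E -!big_split; apply: eq_bigr => s _ /=.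
have [M [MM M0 ME]] := matching_exists s.
by rewrite -!mulrDr -!natrD !ME (matching_merge MM M0 ia ic ab cd ac).
Qed.

Definition two_to_one (i : X -> C) : Prop := forall x, exists2 y, x != y &
  forall z, (i z == i x) = (z == x) || (z == y).

Lemma pairing_sum_two_to_one f i : pairing_sum f -> #|C| = (2 * l)%N ->
  im i = setT -> f i != 0 -> two_to_one i.
Proof.
move=> fP lC iS f0 x; have [s si] := pairing_sum_neq0 fP f0.
have sS : im (i \o s) = setT by rewrite im_perm.
have jI := bij_inj (paired_bij sS si lC).
have fE q c : i (s (pslot q c)) = i (s (pslot q false)).
  by case: c => //; have /eqP := forallP si q.
rewrite -[x](permKV s); have [q [c ->]] := pslotP (s^-1%g x).
exists (s (pslot q (~~ c))).
  by rewrite (inj_eq perm_inj); apply/eqP => /pslot_inj[_]; case: c.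
move=> z; rewrite -[z](permKV s); have [q' [c' ->]] := pslotP (s^-1%g z).
rewrite !(inj_eq perm_inj) fE (fE q) (inj_eq jI).
apply/eqP/orP => [->|[] /eqP /pslot_inj[] //].
by case: c c' => [] []; rewrite eqxx; auto.
Qed.

End Pairing.

(** * Reduction to contractions within each curvature factor *)

Section Reduction.
Variables (R : numDomainType) (C : finType) (l : nat).
Let X := 'I_(4 * l).

Definition upd (i : X -> C) (k : 'I_l) (p q r t : C) (x : X) : C :=
  if x == slot k i4_0 then p else if x == slot k i4_1 then q else
  if x == slot k i4_2 then r else if x == slot k i4_3 then t else i x.

Lemma slot_eq n (k k' : 'I_l) (j j' : 'I_n) :
  (slot k j == slot k' j') = (k == k') && (j == j').
Proof. by apply/eqP/andP => [/slot_inj[-> ->]//|[/eqP-> /eqP->]]. Qed.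

Lemma updE i k p q r t k' j :
  upd i k p q r t (slot k' j) = if k' == k then quad p q r t j else i (slot k' j).
Proof.
by rewrite /upd !slot_eq; case: (k' == k) => //=; elim/ord4_case: j.
Qed.

Variable f : (X -> C) -> R.
Hypothesis f_ext : forall i j, i =1 j -> f i = f j.
Hypothesis f_color : forall (u : C -> C) i, injective u -> f (u \o i) = f i.
Hypothesis f_two : forall i, f i != 0 -> two_to_one i.
(** The three ways to match four slots add up to the value at a colouring that
    gives one colour to the four slots and omits another colour altogether. *)
Hypothesis f_three : forall i (a b c d : X),
  (forall z, (i z == i a) = (z == a) || (z == b)) ->
  (forall z, (i z == i c) = (z == c) || (z == d)) ->
  a != b -> c != d -> i a != i c ->
  f i + f (i \o tperm b c) + f (i \o tperm b d) = 0.
Hypothesis f_curv : forall i k,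
  curvature_like (fun p q r t => f (upd i k p q r t)).

Lemma double_eq0 (x : R) : x = - x -> x = 0.
Proof.
by move/eqP; rewrite -addr_eq0 -mulr2n mulrn_eq0 /= => /eqP.
Qed.

(** The three-term relation becomes antisymmetry as soon as the term in which
    [s] and [t] are matched together drops out. *)
Lemma exchange i s t : two_to_one i -> i s != i t ->
  (forall p, p != s -> i p = i s -> f (i \o tperm p t) = 0) ->
  f (i \o tperm s t) = - f i.
Proof.
move=> i2 st H; have [p sp pE] := i2 s; have [q tq qE] := i2 t.
have ip : i p = i s by apply/eqP; rewrite pE eqxx orbT.
have iq : i q = i t by apply/eqP; rewrite qE eqxx orbT.
have ps : p != s by rewrite eq_sym.
have := f_three pE qE sp tq st; rewrite (H p ps ip) addr0 => /eqP.
rewrite addrC addr_eq0 => /eqP <-.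
(* Exchanging the partners differs from exchanging s and t by a renaming of the
   two colours. *)
rewrite -(f_color (i \o tperm p q) (@perm_inj _ (tperm (i s) (i t)))).
apply: f_ext => z /=.
have [zs|zs] := eqVneq z s.
  have qs : q != s by apply: contraNneq st => <-; rewrite iq.
  by rewrite zs tpermL (tpermD ps qs) tpermL.
have [zt|zt] := eqVneq z t.
  have pt : p != t by apply: contraNneq st => <-; rewrite ip.
  have qt : q != t by rewrite eq_sym.
  by rewrite zt tpermR (tpermD pt qt) tpermR.
rewrite (@tpermD _ s t z) 1?eq_sym //.
have [zp|zp] := eqVneq z p; first by rewrite zp tpermL iq tpermR ip.
have [zq|zq] := eqVneq z q; first by rewrite zq tpermR ip tpermL iq.
by rewrite !tpermD // eq_sym ?pE ?qE // negb_or ?zs ?zp ?zt.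
Qed.

Definition std_block (i : X -> C) k :=
  (i (slot k i4_0) == i (slot k i4_3)) && (i (slot k i4_1) == i (slot k i4_2)).

(** B is the first block not yet matched within itself. *)
Section Block.
Variables (B : 'I_l).
Let s0 := slot B i4_0.
Let s1 := slot B i4_1.
Let s2 := slot B i4_2.
Let s3 := slot B i4_3.

Hypothesis std0 : forall i, (forall k : 'I_l, (k <= B)%N -> std_block i k) -> f i = 0.

Definition pre_std (i : X -> C) := forall k : 'I_l, (k < B)%N -> std_block i k.

(** An earlier block is matched within itself, so it cannot contain the partner
    of a slot of B. *)
Lemma pre_std_late i p j : two_to_one i -> pre_std i -> i p = i (slot B j) ->
  (4 * B <= p)%N.
Proof.
move=> i2 ist; have [k [j' ->]] := slotP p => E.
have [kB|kB] := ltnP k B; last by rewrite /= (leq_trans _ (leq_addr _ _)) // leq_mul2l.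
have /andP[/eqP e03 /eqP e12] := ist k kB.
have [j'' jj e'] : exists2 j'', j'' != j' & i (slot k j'') = i (slot k j').
  elim/ord4_case: j' {E}; [exists 3 | exists 2 | exists 1 | exists 0] => //.
have nk : k != B by apply: contraTneq kB => ->; rewrite ltnn.
have [y _ yE] := i2 (slot B j).
have := yE (slot k j'); rewrite E eqxx slot_eq (negPf nk) /= => /esym/eqP yy.
have := yE (slot k j''); rewrite e' E eqxx slot_eq (negPf nk) /= -yy slot_eq.
by rewrite eqxx (negPf jj).
Qed.

Lemma pre_std_ext i i' : pre_std i ->
  (forall x : X, (x < 4 * B)%N -> i' x = i x) -> pre_std i'.
Proof.
move=> H E k kB; rewrite /std_block !E; first exact: H.
all: rewrite /= (leq_trans (n := 4 * k.+1)%N) ?leq_mul2l //.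
all: by rewrite mulnS addnC ltn_add2r.
Qed.

Lemma slotB_late (j : 'I_4) : (4 * B <= slot B j)%N.
Proof. exact: leq_addr. Qed.

Lemma pre_std_tperm i (x y : X) : pre_std i -> (4 * B <= x)%N -> (4 * B <= y)%N ->
  pre_std (i \o tperm x y).
Proof.
move=> H hx hy; apply: pre_std_ext H _ => z zB /=.
by rewrite tpermD //; apply: contraTneq zB => <-; rewrite -leqNgt.
Qed.

Lemma upd_self i : upd i B (i s0) (i s1) (i s2) (i s3) =1 i.
Proof.
move=> x; rewrite /upd -/s0 -/s1 -/s2 -/s3.
by do 4 (case: eqP => [->//|_]).
Qed.

Lemma pre_std_upd i p q r t : pre_std i -> pre_std (upd i B p q r t).
Proof.
move=> H; apply: pre_std_ext H _ => x xB; rewrite /upd.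
have N (j : 'I_4) : x == slot B j = false.
  by apply: contraTF xB => /eqP ->; rewrite -leqNgt slotB_late.
by rewrite !N.
Qed.

Lemma upd_upd i p q r t p' q' r' t' :
  upd (upd i B p q r t) B p' q' r' t' =1 upd i B p' q' r' t'.
Proof. by move=> x; rewrite /upd; do 4 (case: eqP => // _). Qed.

Lemma tperm_upd i (a b : 'I_4) : i \o tperm (slot B a) (slot B b) =1
  upd i B (i (slot B (tperm a b 0))) (i (slot B (tperm a b 1)))
          (i (slot B (tperm a b 2))) (i (slot B (tperm a b 3))).
Proof.
have sI : injective (@slot 4 l B) by move=> j j' /slot_inj[].
move=> x; have [k [j ->]] := slotP x; rewrite updE.
have [->|kB] := eqVneq k B.
  by rewrite /= -inj_tperm // (quadK (fun j => i (slot B (tperm a b j)))).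
by rewrite /= tpermD // slot_eq eq_sym (negPf kB).
Qed.

Lemma upd_at i p q r t : let i' := upd i B p q r t in
  [/\ i' s0 = p, i' s1 = q, i' s2 = r & i' s3 = t].
Proof. by rewrite /= !updE eqxx. Qed.

Lemma curv_anti i p q r t : f (upd i B p q r t) = - f (upd i B q p r t).
Proof. by case: (f_curv i B) => TA _ _; rewrite TA. Qed.

Lemma f_upd i : f i = f (upd i B (i s0) (i s1) (i s2) (i s3)).
Proof. by apply: f_ext => x; rewrite upd_self. Qed.

Lemma block_eq01 i : i s0 = i s1 -> f i = 0.
Proof. by move=> E; rewrite f_upd E; apply: double_eq0; exact: curv_anti. Qed.

Lemma block_std i : pre_std i -> i s0 = i s3 -> i s1 = i s2 -> f i = 0.
Proof.
move=> H E03 E12; apply: std0 => k; rewrite leq_eqVlt => /orP[/eqP kB|]; last exact: H.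
by have -> : k = B; [exact: val_inj | rewrite /std_block E03 E12 !eqxx].
Qed.

(** Swapping the first two indices of the block makes it standard. *)
Lemma block_cross i : pre_std i -> i s0 = i s2 -> i s1 = i s3 -> f i = 0.
Proof.
move=> H E02 E13; rewrite f_upd curv_anti E02 E13 block_std ?oppr0 //.
- exact: pre_std_upd.
- by case: (upd_at i (i s3) (i s2) (i s2) (i s3)) => -> _ _ ->.
by case: (upd_at i (i s3) (i s2) (i s2) (i s3)) => _ -> -> _.
Qed.

(** One contraction inside the factor: the factor enters through its Ricci
    tensor, which is symmetric, whereas the exchange makes it antisymmetric. *)
Lemma block_eq02 i : pre_std i -> i s0 = i s2 -> f i = 0.
Proof.
move=> H E02; have [//|fi] := eqVneq (f i) 0; have i2 := f_two fi.
have [E13|N13] := eqVneq (i s1) (i s3); first exact: block_cross.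
have N01 : i s0 != i s1 by apply: contraNneq fi => /block_eq01 ->.
apply: double_eq0; rewrite -(@exchange i s1 s3) //.
  rewrite f_upd (cl_pair (f_curv i B)); apply: f_ext => x.
  rewrite tperm_upd !(tpermL, tpermR) !tpermD //.
  by rewrite -/s0 -/s1 -/s2 -/s3 E02.
move=> p ps pE; have p0 : p != s0 by apply: contraNneq N01 => <-; rewrite pE.
have p2 : p != s2 by apply: contraNneq N01 => E; rewrite E02 -E pE.
apply: block_cross => /=.
- by apply: (pre_std_tperm H _ (slotB_late _)); apply: pre_std_late i2 H pE.
- by rewrite !tpermD // slot_eq andbC.
by rewrite tpermR tpermD ?pE // slot_eq andbC.
Qed.

(** The exchange makes f antisymmetric in the first three indices of the block,
    and the Bianchi identity then gives 3 f = 0. *)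
Lemma block_zero i : pre_std i -> f i = 0.
Proof.
have ex02 i' : pre_std i' -> f i' != 0 ->
    f (upd i' B (i' s2) (i' s1) (i' s0) (i' s3)) = - f i'.
  move=> H fi; have i2 := f_two fi.
  have N02 : i' s0 != i' s2 by apply: contraNneq fi => E; rewrite block_eq02.
  rewrite -(@exchange i' s0 s2) //.
    apply: f_ext => x; rewrite tperm_upd !(tpermL, tpermR) !tpermD //.
  move=> p ps pE; apply: block_eq02 => /=.
    by apply: (pre_std_tperm H _ (slotB_late _)); apply: pre_std_late i2 H pE.
  by rewrite tpermR tpermD ?pE // slot_eq andbC.
move=> H; have [//|fi] := eqVneq (f i) 0.
pose i' := upd i B (i s1) (i s0) (i s2) (i s3).
have fi' : f i' = - f i by rewrite [in RHS]f_upd curv_anti opprK.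
have [] := upd_at i (i s1) (i s0) (i s2) (i s3); rewrite -/i' => i'0 i'1 i'2 i'3.
(* Both cyclic shifts are products of two sign changes. *)
have E1 : f (upd i B (i s1) (i s2) (i s0) (i s3)) = f i.
  by rewrite curv_anti ex02 // opprK.
have E2 : f (upd i B (i s2) (i s0) (i s1) (i s3)) = f i.
  have := ex02 i' (pre_std_upd _ _ _ _ H).
  rewrite i'0 i'1 i'2 i'3 fi' oppr_eq0 opprK => /(_ fi) <-.
  by apply: f_ext => x; rewrite upd_upd.
have := cl_bianchi (f_curv i B) (i s0) (i s1) (i s2) (i s3).
rewrite E1 E2 -f_upd => /eqP.
by rewrite -mulr2n -mulrSr mulrn_eq0 (negPf fi).
Qed.

End Block.

(** The blocks are matched within themselves one after the other; making one
    standard does not disturb the earlier ones. *)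
Lemma std_blocks_determine :
  (forall i, (forall k, std_block i k) -> f i = 0) -> forall i, f i = 0.
Proof.
move=> f0; suff H n : (n <= l)%N -> forall i,
    (forall k : 'I_l, (k < n)%N -> std_block i k) -> f i = 0.
  by move=> i; apply: (H 0%N).
move=> nl; rewrite -(subKn nl); elim: (l - n)%N => [|m IH] i H.
  by apply: f0 => k; apply: H; rewrite subn0.
have [lm|ml] := leqP l m.
  by apply: IH => k; rewrite (eqP lm); apply: contraTT => _; rewrite -leqNgt.
have hB : (l - m.+1 < l)%N by rewrite ltn_subrL (leq_ltn_trans _ ml).
apply: (@block_zero (Ordinal hB)) => // i' H'; apply: IH => k kB.
by apply: H'; rewrite /= -ltnS -subSn.
Qed.

End Reduction.

Section StandardColoring.
Variables (C : finType) (l : nat).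
Let X := 'I_(4 * l).

Definition std_color (i : X -> C) (q : 'I_l * bool) : C :=
  i (slot q.1 (if q.2 then i4_1 else i4_0)).

(** In a standard block the slots 1 and 2 share a colour, as do 0 and 3. *)
Definition middle (j : 'I_4) : bool := (j == 1) || (j == 2).

Lemma std_colorE (i : X -> C) k j : (forall k, std_block i k) ->
  i (slot k j) = std_color i (k, middle j).
Proof.
by move=> /(_ k) /andP[/eqP E0 /eqP E1]; elim/ord4_case: j; rewrite /std_color.
Qed.

Lemma std_color_inj (i : X -> C) : (forall k, std_block i k) -> two_to_one i ->
  injective (std_color i).
Proof.
move=> ist i2 [k b] [k' b']; rewrite /std_color /= => E.
have [y xy yE] := i2 (slot k (if b then i4_1 else i4_0)).
have := yE (slot k (if b then i4_2 else i4_3)).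
rewrite (std_colorE _ _ ist) [X in _ == X](std_colorE _ _ ist).
have -> : middle (if b then i4_2 else i4_3) = middle (if b then i4_1 else i4_0).
  by case: (b).
rewrite eqxx slot_eq eqxx /=; have -> : ((if b then i4_2 else i4_3) == (if b then i4_1 else i4_0)) = false.
  by case: (b).
move=> /esym /eqP yy; have := yE (slot k' (if b' then i4_1 else i4_0)).
rewrite -E eqxx -yy !slot_eq eq_sym.
by case/esym/orP => /andP[/eqP-> ]; case: (b); case: (b').
Qed.

(** A standard two-to-one colouring is the same as a bijection from the 2l pairs
    (0 3) and (1 2) of the blocks to the colours. *)
Lemma std_color_orbit (i i0 : X -> C) : #|C| = (2 * l)%N ->
  (forall k, std_block i k) -> two_to_one i ->
  (forall k, std_block i0 k) -> two_to_one i0 ->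
  exists2 u : C -> C, injective u & i =1 u \o i0.
Proof.
move=> lC st i2 st0 i20.
have [v vK Kv] : bijective (std_color i0).
  apply: inj_card_bij; first exact: std_color_inj.
  by rewrite lC card_prod card_ord card_bool mulnC.
exists (std_color i \o v).
  by apply: inj_comp; [exact: std_color_inj | exact: can_inj Kv].
move=> x; have [k [j ->]] := slotP x.
by rewrite /= (std_colorE _ _ st) (std_colorE _ _ st0) vK.
Qed.

End StandardColoring.

(** * The polarized invariant *)

Section Polarized.
Variables (R : realType) (C : finType) (l : nat).
Let X := 'I_(4 * l).
Variable c : 'S_(4 * l) -> R.
Implicit Types (i : X -> C) (x : {ffun X -> C}).

Notation K := (@curvature_kernel R C).
Notation F := (inv_coef c (diag_metric (fun=> 1 : R))).

Definition kernel_at i (k : 'I_l) x (k' : 'I_l) : R :=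
  K (i (slot k i4_0)) (i (slot k i4_1)) (i (slot k i4_2)) (i (slot k i4_3))
    (x (slot k' i4_0)) (x (slot k' i4_1)) (x (slot k' i4_2)) (x (slot k' i4_3)).

(** The complete polarization of the invariant, at the curvature kernels whose
    indices are the blocks of i; g assigns the kernels to the tensor factors. *)
Definition polarized i : R :=
  \sum_(g : {perm 'I_l}) \sum_(x : {ffun X -> C}) F x * \prod_k kernel_at i k x (g k).

Lemma inv_coef_pairing : pairing_sum (fun i : X -> C => F i).
Proof.
exists (fun s => c s^-1%g) => i; rewrite /inv_coef (reindex_inj invg_inj).
by apply: eq_bigr => s _ /=; rewrite invgK metric_prod_paired.
Qed.

Lemma block_perm_exists (g : {perm 'I_l}) (h : 'I_l -> {perm 'I_4}) :
  exists s : {perm X}, forall k j, s (slot k j) = slot (g k) (h k j).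
Proof.
have [v vK Kv] := @slot_bij 4 l.
pose s0 (y : X) := slot (g (v y).1) (h (v y).1 (v y).2).
have s0E k j : s0 (slot k j) = slot (g k) (h k j) by rewrite /s0 (vK (k, j)).
have s0I : injective s0.
  move=> x y; have [k [j ->]] := slotP x; have [k' [j' ->]] := slotP y.
  rewrite !s0E => /slot_inj[/perm_inj <-] => /perm_inj -> //.
by exists (perm s0I) => k j; rewrite permE s0E.
Qed.

(** Expanding the kernels permutes the slots within the blocks and g permutes the
    blocks, so each term is the initial functional after a permutation of the
    slots. *)
Lemma polarized_pairing : pairing_sum polarized.
Proof.
apply: pairing_sum_sum => g; have [w wE] := kernel_perm R C.
apply: (@pairing_sum_ext _ _ _ (fun i => \sum_(h : {ffun 'I_l -> {perm 'I_4}})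
  \sum_(x : {ffun X -> C}) F x * \prod_k (w (h k) * [forall j, i (slot k j) == x (slot (g k) (h k j))]%:R))).
  move=> i; rewrite exchange_big; apply: eq_bigr => x _; rewrite -mulr_sumr.
  congr (_ * _); rewrite -(bigA_distr_bigA (fun k (s : {perm 'I_4}) =>
    w s * [forall j, i (slot k j) == x (slot (g k) (s j))]%:R)).
  apply: eq_bigr => k _.
  rewrite /kernel_at (wE _ _ _ _ (fun j => x (slot (g k) j))); apply: eq_bigr => s _.
  by congr (_ * _%:R); congr nat_of_bool; apply: eq_forallb => j; rewrite (quadK (fun j => i (slot k j))).
apply: pairing_sum_sum => h; have [s sE] := block_perm_exists g h.
apply: (@pairing_sum_ext _ _ _ (fun i => (\prod_k w (h k)) * F (i \o s^-1%g))).
  move=> i; rewrite (bigD1 [ffun y => i (s^-1%g y)]) //= [X in _ + X]big1 ?addr0; last first.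
    move=> x xi; have [/forallP H|/forallPn[k /forallPn[j H]]] :=
        boolP [forall k, [forall j, i (slot k j) == x (slot (g k) (h k j))]].
      case/eqP: xi; apply/ffunP => y; rewrite ffunE -[in LHS](permKV s y).
      have [k [j ->]] := slotP (s^-1%g y); rewrite sE.
      by have /forallP/(_ j)/eqP <- := H k.
    rewrite (bigD1 k) //= (_ : [forall j, _] = false) ?mulr0 ?mul0r ?mulr0 //.
    by apply/negbTE/forallPn; exists j.
  rewrite mulrC; congr (_ * _).
    by apply: eq_bigr => u _; congr (_ * _); apply: eq_metric_prod => y; rewrite /= ffunE.
  apply: eq_bigr => k _; rewrite (_ : [forall j, _] = true) ?mulr1 //.
  by apply/forallP => j; rewrite ffunE -sE permK.
apply: pairing_sum_scale; exact: (pairing_sum_perm s^-1%g inv_coef_pairing).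
Qed.

(** Only the kernel of the block k depends on the four new indices. *)
Lemma polarized_curvature i k :
  curvature_like (fun p q r t => polarized (upd i k p q r t)).
Proof.
pose u (gx : {perm 'I_l} * {ffun X -> C}) : R := F gx.2 *
  \prod_(k' | k' != k) kernel_at i k' gx.2 (gx.1 k').
pose T (gx : {perm 'I_l} * {ffun X -> C}) p q r t : R := K p q r t
  (gx.2 (slot (gx.1 k) i4_0)) (gx.2 (slot (gx.1 k) i4_1))
  (gx.2 (slot (gx.1 k) i4_2)) (gx.2 (slot (gx.1 k) i4_3)).
have H : curvature_like (fun p q r t => \sum_gx u gx * T gx p q r t).
  apply: curvature_like_sum => gx; split=> *; rewrite /T.
  - by rewrite kernel_anti01.
  - by rewrite kernel_pair.
  exact: kernel_bianchi.
have E p q r t : polarized (upd i k p q r t) = \sum_gx u gx * T gx p q r t.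
  rewrite /polarized pair_bigA /=; apply: eq_bigr => -[g x] _ /=.
  rewrite (bigD1 k) //= /u /T -mulrA; congr (_ * _); rewrite mulrC; congr (_ * _).
    apply: eq_bigr => k' /negPf kk; by rewrite /kernel_at !updE kk.
  by rewrite /kernel_at !updE eqxx.
case: H => HA HP HB; split=> *; rewrite !E; [exact: HA | exact: HP | exact: HB].
Qed.

(** The symmetrizer multiplies each of the l curvature factors by 24, and the l!
    assignments of the factors contribute equally. *)
Lemma polarized_inv_val T : curvature_like T ->
  \sum_(i : {ffun X -> C}) polarized i * tensor_prod T i =
  (24 ^+ l *+ l`!) * inv_val c (diag_metric (fun=> 1)) T.
Proof.
move=> clT; under eq_bigr => i _ do rewrite /polarized mulr_suml.
rewrite exchange_big /=.
rewrite (eq_bigr (fun=> 24 ^+ l * inv_val c (diag_metric (fun=> 1)) T)).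
  by rewrite sumr_const card_Sn mulrnAl.
move=> g _; under eq_bigr => i _ do rewrite mulr_suml.
rewrite exchange_big inv_valE mulr_sumr; apply: eq_bigr => x _ /=.
under eq_bigr => i _ do rewrite -mulrA -big_split /=.
rewrite -mulr_sumr mulrCA; congr (_ * _).
rewrite -(prod_sum4 (fun k p q r t => K p q r t (x (slot (g k) i4_0))
  (x (slot (g k) i4_1)) (x (slot (g k) i4_2)) (x (slot (g k) i4_3)) * T p q r t)).
under eq_bigr => k _ do rewrite sum_kernel symmetrize_id //.
rewrite big_split /= prodr_const card_ord; congr (_ * _).
by rewrite [RHS](reindex_inj (@perm_inj _ g)).
Qed.

End Polarized.

Section PolarizedVanishing.
Variables (R : realType) (l n : nat) (c : 'S_(4 * l) -> R).
Hypothesis c0 : vanishing c n.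
Let X := 'I_(4 * l).
Implicit Type i : X -> 'I_n.+1.

(** Permuting the indices of a component introduces no new index. *)
Lemma kernel_support (C : finType) p q r t a b e f :
  @curvature_kernel R C p q r t a b e f != 0 ->
  all (fun z => z \in [:: p; q; r; t]) [:: a; b; e; f].
Proof.
have [w wE] := kernel_perm R C; have E := wE p q r t (quad a b e f).
rewrite /quad /= -/(quad _ _ _ _) in E; rewrite E => H.
have /existsP[s /forallP sE] : [exists s : {perm 'I_4},
    [forall j, quad p q r t j == quad a b e f (s j)]].
  apply: contraNT H => /existsPn H; rewrite big1 // => s _.
  by rewrite (negPf (H s)) mulr0.
have qM j : quad a b e f j \in [:: p; q; r; t].
  rewrite -[j](permKV s) -(eqP (sE _)); exact: mem_nth.
by rewrite /= (qM 0) (qM 1) (qM 2) (qM 3).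
Qed.

(** The polarization is the alternating sum of the values of the invariant at the
    partial sums of the kernels, and these all omit the same index as i. *)
Lemma polarized_vanish i : im i != setT -> polarized c i = 0.
Proof.
move=> iS; pose F (x : {ffun X -> 'I_n.+1}) := inv_coef c (diag_metric (fun=> 1)) x.
pose G (h : {ffun 'I_l -> 'I_l}) := \sum_x F x * \prod_k kernel_at R i (h k) x k.
(* By distributivity the sum over the maps h into S is the invariant of the sum
   of the kernels of the blocks in S. *)
have G0 (S : {set 'I_l}) : \sum_(h : {ffun 'I_l -> 'I_l} | im h \subset S) G h = 0.
  pose T p q r t := \sum_(k in S) 1 * curvature_kernel R (i (slot k i4_0))
     (i (slot k i4_1)) (i (slot k i4_2)) (i (slot k i4_3)) p q r t.
  have clT : curvature_like T by apply: curvature_like_sum => k; apply: symmetrize_curvature.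
  have TE a b e f : cut (im i) T a b e f = T a b e f.
    rewrite /cut; case: (boolP (all _ _)) => // H; rewrite mulr0n /T big1 // => k _.
    apply/eqP; rewrite mul1r; apply: contraNT H => /kernel_support /allP H.
    by apply/allP => z /H; rewrite !inE => /or4P[] /eqP->; exact: imset_f.
  rewrite exchange_big -[RHS](inv_val_cut c0 (fun=> oner_neq0 R) iS clT) inv_valE.
  apply: eq_bigr => x _ /=; rewrite -mulr_sumr; congr (_ * _).
  transitivity (tensor_prod T x); last by apply: eq_bigr => k _; rewrite TE.
  rewrite /tensor_prod /T; under [RHS]eq_bigr => k _ do under eq_bigr => a _ do rewrite mul1r.
  rewrite (bigA_distr_big _ (fun k a => kernel_at R i a x k)) /=.
  apply: eq_bigl => h; apply/subsetP/ffun_onP => [H k|H _ /imsetP[k _ ->]]; last exact: H.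
  by apply: H; exact: imset_f.
have := sum_surjections (fun S _ => G0 S).
have -> : \sum_h G h = 0 by rewrite -[RHS](G0 setT); apply: eq_bigl => h; rewrite subsetT.
(* The surjections of 'I_l are the permutations. *)
pose H (g : {perm 'I_l}) := [ffun k => g^-1%g k].
have HI : injective H.
  move=> g g' /ffunP E; apply: invg_inj; apply/permP => k.
  by have := E k; rewrite !ffunE.
rewrite (eq_bigl (fun h => h \in H @: setT)) => [|h]; last first.
  apply/eqP/imsetP => [hS|[g _ ->]]; last first.
    by apply/setP => k; rewrite inE; apply/imsetP; exists (g k); rewrite // ffunE permK.
  have hI : injective h.
    have /imset_injP hI : #|im h| == #|'I_l| by rewrite hS cardsT.
    by move=> k k'; apply: hI.
  exists (perm hI)^-1%g => //; apply/ffunP => k; rewrite ffunE invgK permE //.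
rewrite big_imset /=; last by move=> g g' _ _; apply: HI.
move=> E; rewrite [RHS]E /polarized.
rewrite [RHS](eq_bigl xpredT) => [|g]; last by rewrite inE.
apply: eq_bigr => g _; apply: eq_bigr => x _; congr (_ * _).
rewrite [RHS](reindex_inj (@perm_inj _ g)) /=.
by apply: eq_bigr => k _; rewrite ffunE permK.
Qed.

End PolarizedVanishing.

(** * The Pfaffian *)

Lemma prod_slot2 (R : comNzRingType) l (g : 'I_(2 * l) -> R) :
  \prod_a g a = \prod_k (g (slot k (0 : 'I_2)) * g (slot k (1 : 'I_2))).
Proof.
rewrite (reindex _ (onW_bij _ (@slot_bij 2 l))) -(pair_bigA _ (fun k j => g (slot k j))).
apply: eq_bigr => k _; rewrite !big_ord_recr big_ord0 /= mul1r.
by congr (g (slot k _) * g (slot k _)); apply: val_inj.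
Qed.

Section Pfaffian.
Variables (R : realType) (l : nat).

Lemma even_pos_subproof (a : 'I_(2 * l)) : (2 * a < 4 * l)%N.
Proof. by case: a => a /=; lia. Qed.

Lemma odd_pos_subproof (a : 'I_(2 * l)) : (2 * a + 1 < 4 * l)%N.
Proof. by case: a => a /=; lia. Qed.

(** The a-th metric factor of a contraction has the slots 2a and 2a + 1, which
    hold the a-th index of i and the index of j that s associates with it. *)
Definition even_pos a : 'I_(4 * l) := Ordinal (even_pos_subproof a).
Definition odd_pos a : 'I_(4 * l) := Ordinal (odd_pos_subproof a).

Lemma even_pos_slot k : even_pos (slot k 0) = slot k 0 /\ even_pos (slot k 1) = slot k 2.
Proof. by split; apply: val_inj => /=; lia. Qed.

Lemma odd_pos_slot k : odd_pos (slot k 0) = slot k 1 /\ odd_pos (slot k 1) = slot k 3.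
Proof. by split; apply: val_inj => /=; lia. Qed.

Lemma pfaffian_perm (s : 'S_(2 * l)) : exists u : 'S_(4 * l), forall k,
  [/\ u (slot k 0) = even_pos (slot k 0), u (slot k 1) = even_pos (slot k 1),
      u (slot k 2) = odd_pos (s^-1%g (slot k 1)) &
      u (slot k 3) = odd_pos (s^-1%g (slot k 0))].
Proof.
have [v vK Kv] := @slot_bij 4 l.
pose h k (j : 'I_4) : 'I_(4 * l) := nth (even_pos (slot k 0))
  [:: even_pos (slot k 0); even_pos (slot k 1);
      odd_pos (s^-1%g (slot k 1)); odd_pos (s^-1%g (slot k 0))] j.
pose u0 (x : 'I_(4 * l)) := h (v x).1 (v x).2.
have uE k j : u0 (slot k j) = h k j by rewrite /u0 (vK (k, j)).
have eI a b : even_pos a = even_pos b -> a = b.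
  by move=> /(congr1 val) /= E; apply: val_inj => /=; lia.
have oI a b : odd_pos a = odd_pos b -> a = b.
  by move=> /(congr1 val) /= E; apply: val_inj => /=; lia.
have eo a b : even_pos a <> odd_pos b by move=> /(congr1 val) /=; lia.
have uI : injective u0.
  move=> x y; have [k [j ->]] := slotP x; have [k' [j' ->]] := slotP y.
  rewrite !uE; elim/ord4_case: j; elim/ord4_case: j'; rewrite /h /=;
    by [move/eI/slot_inj => [-> //] | move/oI/perm_inj/slot_inj => [-> //]
       | move/eo | move/esym/eo].
exists (perm uI) => k; split; by rewrite [LHS]permE uE.
Qed.

(** The Leibniz term of s joins i_a to j_(s a); reading the arguments of the
    tensor factors in the order of the Pfaffian is the permutation u. *)
Lemma wedge_term (s : 'S_(2 * l)) : exists u : 'S_(4 * l),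
  forall (C : finType) (D : C -> C -> R) (T : C -> C -> C -> C -> R),
  \sum_(i : {ffun 'I_(2 * l) -> C}) \sum_(j : {ffun 'I_(2 * l) -> C})
    (\prod_(k < l) T (i (slot k 0)) (i (slot k 1)) (j (slot k 1)) (j (slot k 0))) *
    \prod_a D (i a) (j (s a)) = contract D T u.
Proof.
have [u uE] := pfaffian_perm s; exists u => C D T.
pose half (x : 'I_(4 * l)) : 'I_(2 * l) := Ordinal (ltac:(by case: x => x /=; lia) : (x./2 < 2 * l)%N).
pose h (z : {ffun 'I_(4 * l) -> C}) :=
  ([ffun a => z (even_pos a)], [ffun b => z (odd_pos (s^-1%g b))]).
rewrite pair_bigA (reindex h) /=.
  apply: eq_bigr => z _; rewrite mulrC; congr (_ * _).
    rewrite prod_slot2; apply: eq_bigr => k _; rewrite !ffunE !permK.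
    by have [-> ->] := even_pos_slot k; have [-> ->] := odd_pos_slot k.
  by apply: eq_bigr => k _; rewrite !ffunE /=; have [-> -> -> ->] := uE k.
exists (fun ij : {ffun 'I_(2 * l) -> C} * {ffun 'I_(2 * l) -> C} =>
    [ffun x : 'I_(4 * l) => if odd x then ij.2 (s (half x)) else ij.1 (half x)]).
  move=> z _; apply/ffunP => x; rewrite !ffunE /= permK.
  by case: ifP => xo; congr (z _); apply: val_inj => /=; lia.
move=> [i j] _; congr pair; apply/ffunP => a; rewrite !ffunE /=.
  rewrite (_ : odd _ = false); last by lia.
  by congr (i _); apply: val_inj => /=; lia.
rewrite (_ : odd _ = true); last by lia.
by rewrite -[in RHS](permKV s a); congr (j (s _)); apply: val_inj => /=; lia.
Qed.

Definition pfaffian_val (C : finType) (D : C -> C -> R) (T : C -> C -> C -> C -> R) : R :=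
  ((8 * pi) ^+ l * l`!%:R)^-1 *
  \sum_(i : {ffun 'I_(2 * l) -> C}) \sum_(j : {ffun 'I_(2 * l) -> C})
    (\prod_(k < l) T (i (slot k (0 : 'I_2))) (i (slot k (1 : 'I_2)))
                     (j (slot k (1 : 'I_2))) (j (slot k (0 : 'I_2)))) *
    \det (\matrix_(a, b) D (i a) (j b)).

(** Expanding the determinant turns each term into a complete contraction,
    with the same coefficients in every dimension. *)
Lemma pfaffian_contractions : exists c : 'S_(4 * l) -> R,
  forall (C : finType) (D : C -> C -> R) T, pfaffian_val D T = inv_val c D T.
Proof.
have [u uE] := fin_all_exists wedge_term.
exists (fun t => ((8 * pi) ^+ l * l`!%:R)^-1 *
  \sum_(s : 'S_(2 * l) | u s == t) (-1) ^+ s) => C D T.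
rewrite /pfaffian_val /inv_val.
under [RHS]eq_bigr => t _ do rewrite -mulrA.
rewrite -mulr_sumr; congr (_ * _).
transitivity (\sum_(s : 'S_(2 * l)) (-1) ^+ s * contract D T (u s)).
  under [RHS]eq_bigr => s _ do rewrite -uE mulr_sumr.
  rewrite [RHS]exchange_big; apply: eq_bigr => i _ /=.
  under [RHS]eq_bigr => s _ do rewrite mulr_sumr.
  rewrite [RHS]exchange_big; apply: eq_bigr => j _ /=.
  rewrite mulr_sumr; apply: eq_bigr => s _; rewrite mulrCA; congr (_ * (_ * _)).
  by apply: eq_bigr => a _; rewrite mxE.
rewrite (partition_big u predT) //=; apply: eq_bigr => t _.
by rewrite mulr_suml; apply: eq_bigr => s /eqP ->.
Qed.

(** The Gram determinant has two equal rows. *)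
Lemma pfaffian_low (C : finType) (D : C -> C -> R) T :
  (#|C| < 2 * l)%N -> pfaffian_val D T = 0.
Proof.
move=> Cl; rewrite /pfaffian_val big1 ?mulr0 // => i _; rewrite big1 // => j _.
have /injectivePn[a [b ab iab]] : ~~ injectiveb i.
  apply: contraL Cl => /injectiveP/leq_card; by rewrite card_ord -leqNgt.
by rewrite (determinant_alternate ab) ?mulr0 // => x; rewrite !mxE iab.
Qed.

(** Each antisymmetrized pair contributes a factor 2 against an alternating
    function of the indices. *)
Lemma sum_alternating (C : finType) (B : 'I_l -> C -> C -> R)
    (W : {ffun 'I_(2 * l) -> C} -> R) :
  (forall (k : 'I_l) (j : {ffun 'I_(2 * l) -> C}), W [ffun x => j (tperm (slot k 0) (slot k 1) x)] = - W j) ->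
  \sum_(j : {ffun 'I_(2 * l) -> C}) (\prod_k (B k (j (slot k 0)) (j (slot k 1)) -
                      B k (j (slot k 1)) (j (slot k 0)))) * W j =
  2 ^+ l * \sum_(j : {ffun 'I_(2 * l) -> C}) (\prod_k B k (j (slot k 0)) (j (slot k 1))) * W j.
Proof.
move=> W_alt.
(* Antisymmetrize the first n pairs only, and increase n. *)
pose Q n k (j : {ffun 'I_(2 * l) -> C}) := B k (j (slot k 0)) (j (slot k 1)) -
  B k (j (slot k 1)) (j (slot k 0)) *+ (k < n)%N.
have H n : (n <= l)%N -> \sum_j (\prod_k Q n k j) * W j =
    2 ^+ n * \sum_(j : {ffun 'I_(2 * l) -> C}) (\prod_k B k (j (slot k 0)) (j (slot k 1))) * W j.
  elim: n => [_|n IH nl].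
    rewrite expr0 mul1r; apply: eq_bigr => j _; congr (_ * _); apply: eq_bigr => k _.
    by rewrite /Q mulr0n subr0.
  have {IH} := IH (ltnW nl); pose K := Ordinal nl.
  pose Z j := (\prod_(k | k != K) Q n k j) * W j.
  have QZ j : (\prod_k Q n k j) * W j = B K (j (slot K 0)) (j (slot K 1)) * Z j.
    by rewrite (bigD1 K) //= {1}/Q /= ltnn mulr0n subr0 mulrA.
  under eq_bigr => j _ do rewrite QZ.
  have QZ' j : (\prod_k Q n.+1 k j) * W j =
    B K (j (slot K 0)) (j (slot K 1)) * Z j - B K (j (slot K 1)) (j (slot K 0)) * Z j.
    rewrite (bigD1 K) //= {1}/Q /= ltnSn mulr1n -mulrBl -mulrA; congr (_ * (_ * _)).
    apply: eq_bigr => k kK; rewrite /Q ltnS leq_eqVlt.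
    by have -> : (k == n :> nat) = false by apply: negbTE.
  under [in X in _ -> X]eq_bigr => j _ do rewrite QZ'.
  rewrite sumrB [X in _ - X](sum_ffun_perm (tperm (slot K 0) (slot K 1))).
  have -> : \sum_(j : {ffun 'I_(2 * l) -> C})
       B K ([ffun x => j (tperm (slot K 0) (slot K 1) x)] (slot K 1))
           ([ffun x => j (tperm (slot K 0) (slot K 1) x)] (slot K 0)) *
       Z [ffun x => j (tperm (slot K 0) (slot K 1) x)] =
     - \sum_(j : {ffun 'I_(2 * l) -> C}) B K (j (slot K 0)) (j (slot K 1)) * Z j.
    rewrite -sumrN; apply: eq_bigr => j _; rewrite !ffunE tpermL tpermR -mulrN.
    congr (_ * _); rewrite /Z W_alt mulrN; congr (- (_ * _)); apply: eq_bigr => k kK.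
    by rewrite /Q !ffunE !tpermD // slot_eq eq_sym (negPf kK).
  by move=> ->; rewrite opprK -mulr2n exprS -mulrA mulr_natl.
rewrite -H //; apply: eq_bigr => j _; congr (_ * _); apply: eq_bigr => k _.
by rewrite /Q ltn_ord.
Qed.

(** The curvature tensor of the unit sphere in an orthonormal frame. *)
Definition sphere (C : finType) (p q r t : C) : R :=
  (p == t)%:R * (q == r)%:R - (p == r)%:R * (q == t)%:R.

Lemma sphere_curvature (C : finType) : curvature_like (@sphere C).
Proof.
split=> p q r t; rewrite /sphere; first by ring.
  by rewrite ![r == _]eq_sym ![t == _]eq_sym; ring.
by rewrite (eq_sym q p) (eq_sym r p) (eq_sym r q); ring.
Qed.

(** Up to a positive factor the Pfaffian of the unit sphere counts the orderings
    of the indices. *)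
Lemma pfaffian_sphere (C : finType) : #|C| = (2 * l)%N ->
  pfaffian_val (diag_metric (fun=> 1)) (@sphere C) != 0.
Proof.
move=> lC; rewrite /pfaffian_val mulf_neq0 //.
  rewrite invr_eq0 mulf_neq0 ?pnatr_eq0 -?lt0n ?fact_gt0 // expf_neq0 //.
  by rewrite mulf_neq0 // lt0r_neq0 // pi_gt0.
have dE (i j : {ffun 'I_(2 * l) -> C}) (k : 'I_l) :
    \det (\matrix_(a, b) diag_metric (fun=> 1 : R) (i a)
       ([ffun x => j (tperm (slot k (0 : 'I_2)) (slot k (1 : 'I_2)) x)] b)) =
    - \det (\matrix_(a, b) diag_metric (fun=> 1 : R) (i a) (j b)).
  set t := tperm _ _; set M := \matrix_(a, b) _ (j b).
  have -> : (\matrix_(a, b) diag_metric (fun=> 1 : R) (i a) ([ffun x => j (t x)] b)) =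
      col_perm t M.
    by apply/matrixP => a b; rewrite !mxE ffunE.
  by rewrite col_permE det_mulmx det_perm odd_permV odd_tperm slot_eq eqxx /= expr1 mulrN1.
have WE (i : {ffun 'I_(2 * l) -> C}) : \sum_(j : {ffun 'I_(2 * l) -> C})
    (\prod_(k < l) sphere (i (slot k 0)) (i (slot k 1)) (j (slot k 1)) (j (slot k 0))) *
    \det (\matrix_(a, b) diag_metric (fun=> 1 : R) (i a) (j b)) =
    2 ^+ l * (injectiveb i)%:R.
  under eq_bigr => j _ do rewrite /sphere.
  rewrite (sum_alternating (fun k x y => (i (slot k 0) == x)%:R * (i (slot k 1) == y)%:R)) //.
  congr (_ * _); rewrite (bigD1 i) //= [X in _ + X]big1 ?addr0 => [|j ji]; last first.
    rewrite (_ : \prod_k _ = 0) ?mul0r //.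
    have [a ija] : exists a, i a != j a.
      by apply/existsP; apply: contraNT ji => /existsPn E; apply/eqP/ffunP => a;
         apply/esym/eqP; have := E a; rewrite negbK.
    have [k [b ab]] := slotP a; rewrite (bigD1 k) //=.
    have [b0|b1] : b = 0 \/ b = 1.
    - by case: (b) => [[|[|//]] hb]; [left | right]; apply: val_inj.
    - by rewrite -b0 -ab (negPf ija) !mul0r.
    by rewrite -b1 -ab (negPf ija) mulr0 mul0r.
  rewrite big1 ?mul1r => [|k _]; last by rewrite !eqxx mulr1.
  have [/injectiveP iI|/injectivePn[a [b ab iab]]] := boolP (injectiveb i).
    rewrite -[RHS](det1 R (2 * l)); congr determinant; apply/matrixP => a b.
    by rewrite !mxE /diag_metric (inj_eq iI).
  by rewrite (determinant_alternate ab) // => x; rewrite !mxE iab.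
under eq_bigr => i _ do rewrite WE.
rewrite -mulr_sumr mulf_neq0 ?expf_neq0 ?pnatr_eq0 // -natr_sum pnatr_eq0.
have h (a : 'I_(2 * l)) : (a < #|C|)%N by rewrite lC.
pose i0 := [ffun a : 'I_(2 * l) => enum_val (Ordinal (h a))] : {ffun 'I_(2 * l) -> C}.
rewrite (bigD1 i0) //= (_ : injectiveb i0) //.
by apply/injectiveP => a b; rewrite !ffunE => /enum_val_inj [] /val_inj.
Qed.

End Pfaffian.

(** * Restriction of invariants *)

Section Invariants.
Variables (R : realType) (l : nat).
Implicit Types c : 'S_(4 * l) -> R.

Lemma restriction_invariant_of c m b (M : model R m) :
  restriction b (invariant_of c) M = invariant_of c M.
Proof. by apply: eq_bigr => s _; congr (_ * _); exact: restriction_contraction. Qed.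

Lemma invariant_of_coords m (M : model R m) : exists d : 'I_m -> R,
  exists2 T, curvature_like T & (forall a, d a != 0) /\
  forall c, invariant_of c M = inv_val c (diag_metric d) T.
Proof.
have [d [T cT [d0 E]]] := model_coords M; exists d; exists T => //; split=> // c.
by apply: eq_bigr => s _; rewrite E.
Qed.

Lemma vanishing_models c n :
  (forall M : model R n, invariant_of c M = 0) -> vanishing c n.
Proof.
move=> c0 d T d0 cT; have [M ME] := coords_model d0 cT.
by rewrite -[RHS](c0 M); apply: eq_bigr => s _; rewrite ME.
Qed.

(** No surjection onto more than 2l indices is constant on the pairs. *)
Lemma vanishing_step c n : (2 * l < n.+1)%N -> vanishing c n ->
  forall M : model R n.+1, invariant_of c M = 0.
Proof.
move=> ln c0 M; have [d [T cT [d0 ->]]] := invariant_of_coords M.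
rewrite (inv_val_surj c0 d0 cT) big1 // => i /eqP iS.
by rewrite inv_coef_card ?mul0r ?card_ord.
Qed.

Lemma pfaffian_invariant_of : exists c,
  (forall (C : finType) (D : C -> C -> R) T, pfaffian_val l D T = inv_val c D T) /\
  forall m (M : model R m), pfaffian l M = invariant_of c M.
Proof.
have [c cE] := pfaffian_contractions R l; exists c; split=> // m M.
exact: (cE _ (dual_gram (vbasis {:M})) (tensor_coef (vbasis {:M}))).
Qed.

Lemma inv_val_sub c c' a (C : finType) (D : C -> C -> R) T :
  inv_val (fun s => c s - a * c' s) D T = inv_val c D T - a * inv_val c' D T.
Proof.
rewrite /inv_val mulr_sumr -sumrB; apply: eq_bigr => s _.
by rewrite mulrBl mulrA.
Qed.

Lemma polarized_sub (C : finType) c c' a (i : 'I_(4 * l) -> C) :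
  polarized (fun s => c s - a * c' s) i = polarized c i - a * polarized c' i.
Proof.
rewrite /polarized mulr_sumr -sumrB; apply: eq_bigr => g _.
rewrite mulr_sumr -sumrB; apply: eq_bigr => x _.
rewrite mulrA -mulrBl; congr (_ * _); rewrite /inv_coef mulr_sumr -sumrB.
by apply: eq_bigr => s _; rewrite mulrBl mulrA.
Qed.

Section TopDimension.
Variables (n : nat) (ln : n.+1 = (2 * l)%N).
Let X := 'I_(4 * l).
Let C := 'I_n.+1.

Let cardC : #|{: C}| = (2 * l)%N. Proof. by rewrite card_ord. Qed.

Lemma polarized_two_to_one c (i : X -> C) : vanishing c n ->
  polarized c i != 0 -> two_to_one i.
Proof.
move=> c0 fi; apply: (pairing_sum_two_to_one (polarized_pairing C c) cardC _ fi).
by apply/eqP; apply: contraNT fi => /(polarized_vanish c0) ->.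
Qed.

(** The three-term relation holds because the recoloured function omits the
    colour of the slot e. *)
Lemma polarized_std c : vanishing c n ->
  (forall i : X -> C, (forall k, std_block i k) -> polarized c i = 0) ->
  forall i : X -> C, polarized c i = 0.
Proof.
move=> c0; have fP := polarized_pairing C c.
apply: std_blocks_determine.
- by move=> i j; apply: (pairing_sum_eq fP).
- by move=> u i; apply: (pairing_sum_color fP).
- by move=> i; apply: polarized_two_to_one.
- move=> i a b e d ia ie ab ed ae; rewrite (pairing_sum_merge fP ia ie ab ed ae).
  apply: (polarized_vanish c0); apply: contraNneq ae => /setP/(_ (i e)).
  rewrite inE => /imsetP[x _]; case: eqP => [_ -> //|xe /esym //].
exact: polarized_curvature.
Qed.

Lemma polarized_zero c : vanishing c n -> (forall i : X -> C, polarized c i = 0) ->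
  forall T : C -> C -> C -> C -> R, curvature_like T ->
  inv_val c (diag_metric (fun=> 1)) T = 0.
Proof.
move=> c0 f0 T cT; have := polarized_inv_val c cT.
rewrite big1 => [/esym/eqP|i _]; last by rewrite f0 mul0r.
rewrite mulf_eq0 mulrn_eq0 expf_eq0 pnatr_eq0 /= andbF orbF.
by rewrite eqn0Ngt fact_gt0 => /eqP.
Qed.

(** A combination that cancels at one standard colouring cancels at all of them,
    hence everywhere; T provides a standard colouring at which c' does not
    vanish. *)
Lemma vanishing_kernel c c' : vanishing c n -> vanishing c' n ->
  (exists T : C -> C -> C -> C -> R, curvature_like T /\
     inv_val c' (diag_metric (fun=> 1)) T != 0) ->
  exists a, forall M : model R n.+1, invariant_of c M = a * invariant_of c' M.
Proof.
move=> c0 c'0 [S [cS S0]].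
have [/existsP[i0 /andP[/forallP st0 fi0]]|] := boolP
  [exists i : {ffun X -> C}, [forall k, std_block i k] && (polarized c' i != 0)]; last first.
  move/existsPn => H; case/eqP: S0; apply: (polarized_zero c'0) cS.
  apply: (polarized_std c'0) => i ist.
  have iE : [ffun x => i x] =1 i by move=> x; rewrite ffunE.
  have := H [ffun x => i x].
  rewrite (pairing_sum_eq (polarized_pairing C c') iE) (_ : [forall k, _]) /= ?negbK.
    by move/eqP.
  by apply/forallP => k; rewrite /std_block !ffunE; apply: ist.
pose a := polarized c i0 / polarized c' i0; exists a.
pose e s := c s - a * c' s.
have e0 : vanishing e n.
  by move=> d T d0 cT; rewrite inv_val_sub c0 // c'0 // mulr0 subr0.
have fe : forall i : X -> C, polarized e i = 0.
  apply: (polarized_std e0) => i ist.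
  have [//|fi] := eqVneq (polarized e i) 0.
  have [u uI uE] := std_color_orbit cardC ist (polarized_two_to_one e0 fi)
    st0 (polarized_two_to_one c'0 fi0).
  rewrite (pairing_sum_eq (polarized_pairing C e) uE).
  rewrite (pairing_sum_color (polarized_pairing C e) _ uI) polarized_sub.
  by rewrite /a divfK // subrr.
move=> M; have [d [T cT [d0 E]]] := invariant_of_coords M.
apply/eqP; rewrite -subr_eq0 !E -inv_val_sub -/e (inv_val_surj e0 d0 cT).
under eq_bigr => i /eqP iS do rewrite (inv_coef_scale _ _ iS cardC) -mulrA.
rewrite -mulr_sumr -(inv_val_surj e0 (fun=> oner_neq0 R) cT).
by rewrite (polarized_zero e0) ?mulr0.
Qed.

End TopDimension.
End Invariants.

Theorem theorem1p4 (R : realType) (l : nat) (hl : (1 <= l)%N) (b : bool) :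
  [/\ (* r maps J_{2l}(m) to J_{2l}(m-1), for m = n+1 *)
      (forall (n : nat) (P : scalar_family R n.+1),
         is_invariant l P -> is_invariant l (restriction b P)),
      (* r is surjective *)
      (forall (n : nat) (Q : scalar_family R n), is_invariant l Q ->
         exists P : scalar_family R n.+1,
           is_invariant l P /\ restriction b P =1 Q),
      (* r is injective if m > 2l *)
      (forall n : nat, (2 * l < n.+1)%N -> forall P P' : scalar_family R n.+1,
         is_invariant l P -> is_invariant l P' ->
         restriction b P =1 restriction b P' -> P =1 P') &
      (* the kernel of r is spanned by the Pfaffian if m = 2l *)
      (forall n : nat, n.+1 = (2 * l)%N -> forall P : scalar_family R n.+1,
         is_invariant l P /\ restriction b P =1 (fun _ => 0) <->
         exists a : R, P =1 (fun M => a * pfaffian l M))].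
Proof.
have rE n (P : scalar_family R n.+1) (c : 'S_(4 * l) -> R) : P =1 invariant_of c ->
    restriction b P =1 invariant_of c.
  by move=> PE M; rewrite -(restriction_invariant_of c b M); apply: PE.
split.
- by move=> n P [c /rE PE]; exists c.
- move=> n Q [c QE]; exists (invariant_of c); split; first by exists c.
  by move=> M; rewrite QE; apply: restriction_invariant_of.
- move=> n ln P P' [c PE] [c' P'E] rPP' M; pose e s := c s - 1 * c' s.
  have eE m (M' : model R m) : invariant_of e M' = invariant_of c M' - invariant_of c' M'.
    by rewrite -sumrB; apply: eq_bigr => s _; rewrite /e mul1r mulrBl.
  apply/eqP; rewrite PE P'E -subr_eq0 -eE; apply/eqP.
  apply: (vanishing_step ln); apply: vanishing_models => M'.
  by rewrite eE -(rE _ _ _ PE) -(rE _ _ _ P'E) rPP' subrr.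
move=> n ln P; have [cE [pfE pfM]] := pfaffian_invariant_of R l.
have cE0 : vanishing cE n.
  by move=> d T d0 cT; rewrite -pfE pfaffian_low // card_ord -ln.
split=> [[[c PE] rP0]|[a PE]].
  have c0 : vanishing c n by apply: vanishing_models => M; rewrite -(rE _ _ _ PE) rP0.
  have [|a aE] := vanishing_kernel ln c0 cE0.
    exists (@sphere R _); split; first exact: sphere_curvature.
    by rewrite -pfE pfaffian_sphere // card_ord.
  by exists a => M; rewrite PE aE pfM.
have PE' : P =1 invariant_of (fun s => a * cE s).
  move=> M; rewrite PE pfM mulr_sumr; apply: eq_bigr => s _; exact: mulrA.
split; first by exists (fun s => a * cE s).
move=> M; rewrite (rE _ _ _ PE'); have [d [T cT [d0 E]]] := invariant_of_coords l M.
rewrite E; transitivity (a * inv_val cE (diag_metric d) T); last by rewrite cE0 ?mulr0.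
by rewrite [in RHS]/inv_val mulr_sumr; apply: eq_bigr => s _; rewrite mulrA.
Qed.
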